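(* Let $\mathfrak Y=(\mathbb C=A(1)\subset A(2)\subset\dots\subset A(n))$ be a chain of finite-dimensional semisimple $\mathbb Z_2$-graded algebras whose branching graph of graded simple modules is simple (no multiple edges). Then the Gelfand–Tsetlin algebra $GZ(\mathfrak Y)$ coincides with the ordinary Gelfand–Tsetlin algebra $GZ(\mathfrak Y_0)$ of the chain of even parts $A(1)_0\subset\dots\subset A(n)_0$; it is maximal among the commutative subalgebras of $A(n)_0$; and every simple graded $A(n)$-module has a basis of homogeneous vectors that are common eigenvectors of $GZ(\mathfrak Y)$.
   Context: The graded center of a graded algebra $A$ with parity automorphism $\theta$ is $Z(A)=\{a\in A_0: ab=ba\ \forall b\in A\}+\{a\in A_0: ab=\theta(b)a\ \forall b\in A\}$. $GZ(\mathfrak Y)$ is the subalgebra of $A(n)$ generated by $Z(A(1)),\dots,Z(A(n))$. $GZ(\mathfrak Y_0)$ is the subalgebra of $A(n)_0$ generated by the ordinary centers of $A(1)_0,\dots,A(n)_0$. Branching graph: vertices at level $i$ are simple graded $A(i)$-modules up to isomorphism, with $\dim\mathrm{GHom}_{A(i)}(U,V)$ edges from $U$ to $V$. *)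

(* Defs.v *)
From HB Require Import structures.
From mathcomp Require Import all_boot all_order all_algebra all_field.
Set Implicit Arguments. Unset Strict Implicit. Unset Printing Implicit Defensive.
Import GRing.Theory.
Local Open Scope ring_scope.

(* A(n) is modelled by an F-algebra [A : falgType F]; the chain
   A(1) ⊂ ... ⊂ A(n) by subspaces [Ach i : {vspace A}], i = 1..n, with
   Ach n = fullv.  The Z2-grading is given by the parity automorphism
   [th : 'AEnd(A)], an algebra automorphism with th \o th = id. *)

Section Alg.
Variables (F : fieldType) (A : falgType F).

Definition is_subalg (U : {vspace A}) : bool :=
  (1 \in U) && (U * U <= U)%VS.

Definition graded_subalg (th : 'AEnd(A)) (U : {vspace A}) : bool :=
  is_subalg U && (th @: U <= U)%VS.

Definition even_part (th : 'AEnd(A)) (U : {vspace A}) : {vspace A} :=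
  (U :&: fixedSpace th)%VS.

Definition is_ideal (B I : {vspace A}) : bool :=
  [&& (I <= B)%VS, (B * I <= I)%VS & (I * B <= I)%VS].

(* semisimple (finite dimensional): no nonzero nilpotent two-sided ideal,
   i.e. the Jacobson radical is zero *)
Definition semisimple (B : {vspace A}) : Prop :=
  forall I : {vspace A}, is_ideal B I ->
    (exists k, (I ^+ k.+1)%VS = 0%VS) -> I = 0%VS.

(* {a : a * b = th b * a for all b in B}  (twisted centraliser; defined
   exactly as the library's centraliser 'C(B), via a basis of B) *)
Definition twisted_centraliser (th : 'AEnd(A)) (B : {vspace A}) : {vspace A} :=
  (\bigcap_i lker (amulr (tnth (vbasis B) i) - amull (th (tnth (vbasis B) i))))%VS.

Definition graded_center (th : 'AEnd(A)) (B : {vspace A}) : {vspace A} :=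
  ((even_part th B :&: 'C(B)) + (even_part th B :&: twisted_centraliser th B))%VS.

Definition GZ (th : 'AEnd(A)) (Ach : nat -> {vspace A}) (n : nat) : {vspace A} :=
  agenv (\sum_(1 <= i < n.+1) graded_center th (Ach i))%VS.

Definition GZ0 (th : 'AEnd(A)) (Ach : nat -> {vspace A}) (n : nat) : {vspace A} :=
  agenv (\sum_(1 <= i < n.+1) 'Z(even_part th (Ach i)))%VS.

(* Graded modules over a graded subalgebra B of A: a finite-dimensional
   vector space V, an action rho (only its values on B matter) and a grading
   operator J (J^2 = 1; V_0, V_1 = (+1), (-1)-eigenspaces of J). *)
Section Mod.
Variable (th : 'AEnd(A)).

Definition graded_module (B : {vspace A}) (V : vectType F)
    (rho : A -> 'End(V)) (J : 'End(V)) : Prop :=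
  [/\ rho 1 = \1%VF,
      forall k, {in B &, forall a b, rho (k *: a + b) = k *: rho a + rho b},
      {in B &, forall a b, rho (a * b) = (rho a \o rho b)%VF},
      (J \o J = \1)%VF &
      {in B, forall a, rho (th a) = (J \o rho a \o J)%VF}].

Definition graded_submodule (B : {vspace A}) (V : vectType F)
    (rho : A -> 'End(V)) (J : 'End(V)) (W : {vspace V}) : Prop :=
  {in B, forall a, (rho a @: W <= W)%VS} /\ (J @: W <= W)%VS.

Definition simple_gmodule (B : {vspace A}) (V : vectType F)
    (rho : A -> 'End(V)) (J : 'End(V)) : Prop :=
  [/\ graded_module B rho J, (fullv : {vspace V}) != 0%VS &
      forall W : {vspace V}, graded_submodule B rho J W ->
        W = 0%VS \/ W = fullv].

Definition is_ghom (B : {vspace A}) (U V : vectType F)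
    (rhoU : A -> 'End(U)) (JU : 'End(U)) (rhoV : A -> 'End(V)) (JV : 'End(V))
    (f : 'Hom(U, V)) : Prop :=
  {in B, forall a, (f \o rhoU a = rhoV a \o f)%VF} /\ (f \o JU = JV \o f)%VF.

End Mod.
End Alg.

(* Main.v *)
Require Import Defs.
From HB Require Import structures.
From mathcomp Require Import all_boot all_order all_algebra all_field.
Set Implicit Arguments. Unset Strict Implicit. Unset Printing Implicit Defensive.
Import GRing.Theory passmx.
Local Open Scope ring_scope.

(** Every semisimple subalgebra U of A is nondegenerate for the form
    (x, y) |-> tr(L_xy), because a nonzero left ideal of U contains a nonzero
    idempotent (Brauer) and in characteristic 0 such an element has nonzero
    trace.  Dual bases (b_i), (b^i) of U then give the Casimir sums
    sum_i b_i f(b^i): they average linear maps over U, and replace the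
    Wedderburn structure theory throughout.

    Averaging the even central elements of A(i)_0 over A(i), plainly and with a
    twist by th, shows that the graded center of A(i) is the ordinary center of
    A(i)_0, so GZ = GZ0.  For D = A(i)_0 inside E = A(i+1)_0, averaging turns
    an element of E commuting with D into graded A(i)-homomorphisms from simple
    submodules of simple A(i+1)-modules; simplicity of the branching graph makes
    these scalar, so Cent_E(D) is commutative.  The double centraliser theorem
    Cent_E(Cent_E(D)) = D Z(E) then gives Cent_E(D) = Z(D) Z(E), and maximality
    of GZ0 follows by induction on the level.  Finally GZ is commutative and
    semisimple, so its elements and the grading operator are simultaneously
    diagonalizable. *)

(** * Traces of endomorphisms *)

Section Trace.
Variables (F : fieldType) (V : vectType F).

Definition lfun_trace (f : 'End(V)) : F :=
  locked (\tr (mxof (vbasis {:V}) (vbasis {:V}) f)).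

Fact lfun_trace_is_scalar : scalar lfun_trace.
Proof. by move=> k f g; rewrite /lfun_trace -!lock !linearP. Qed.
HB.instance Definition _ :=
  GRing.isSemilinear.Build F 'End(V) F _ lfun_trace
    (GRing.semilinear_linear lfun_trace_is_scalar).

Lemma lfun_traceC (f g : 'End(V)) : lfun_trace (f \o g)%VF = lfun_trace (g \o f)%VF.
Proof. by rewrite /lfun_trace -!lock !(mxof_comp _ _ (vbasisP _)) mxtrace_mulC. Qed.

(** In the rank factorisation [M = C R], idempotence cancels down to [R C = 1], an identity matrix
    whose size is the rank and whose trace is that of [M]. *)
Lemma idempotent_mx_trace n (M : 'M[F]_n) : M *m M = M -> \tr M = (\rank M)%:R.
Proof.
move=> idM; have RC1 : row_base M *m col_base M = 1%:M.
  move: (row_base_free M) (col_base_full M) (mulmx_base M).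
  move: (row_base M) (col_base M) => R C freeR fullC CR.
  apply: (row_free_inj freeR); rewrite /= mul1mx.
  apply: (row_full_inj fullC).
  by rewrite -[R *m C *m R]mulmxA CR mulmxA CR idM.
by rewrite -{1}(mulmx_base M) mxtrace_mulC RC1 mxtrace1.
Qed.

Lemma idempotent_trace_neq0 (f : 'End(V)) :
  [pchar F] =i pred0 -> (f \o f = f)%VF -> f != 0 -> lfun_trace f != 0.
Proof.
move=> F0 ff f0; rewrite /lfun_trace -lock idempotent_mx_trace.
  by rewrite ((pcharf0P _).1 F0) mxrank_eq0 mxof_eq0 ?vbasisP.
by rewrite -(mxof_comp _ _ (vbasisP _)) ff.
Qed.

Definition rank1_lfun (u : V) (phi : {scalar V}) : 'End(V) :=
  linfun (fun y => phi y *: u).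

Lemma rank1_lfunE u phi y : rank1_lfun u phi y = phi y *: u.
Proof.
have lin : linear (fun y : V => phi y *: u).
  by move=> k x z; rewrite linearP scalerDl scalerA.
pose phiL := HB.pack_for {linear V -> V} (fun y : V => phi y *: u)
  (GRing.isSemilinear.Build F V V _ _ (GRing.semilinear_linear lin)).
exact: (lfunE phiL).
Qed.

Lemma rank1_trace u phi : lfun_trace (rank1_lfun u phi) = phi u.
Proof.
rewrite /lfun_trace -lock /mxtrace [in RHS](coord_vbasis (memvf u)) linear_sum /=.
apply: eq_bigr => i _; rewrite !mxE /= vecof_delta rank1_lfunE.
by rewrite linearZ linearZ /= mulrC.
Qed.

End Trace.

(** * The trace form on semisimple subalgebras *)

Section Algebra.
Variables (F : fieldType) (A : falgType F).
Hypothesis F0 : [pchar F] =i pred0.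
Implicit Types (U W L I : {vspace A}) (x y e : A) (f p : 'End(A)).

Lemma amullE x y : amull x y = x * y. Proof. by rewrite lfunE. Qed.
Lemma amulrE x y : amulr x y = y * x. Proof. by rewrite lfunE. Qed.

Lemma prodv_eq0P U W :
  reflect {in U & W, forall x y, x * y = 0} (U * W == 0)%VS.
Proof.
rewrite -subv0; apply: (iffP prodvP) => UW0 x y Ux Wy.
  by apply/eqP; rewrite -memv0 UW0.
by rewrite memv0 UW0.
Qed.

Lemma prodv_neq0_line U W :
  (U * W != 0)%VS -> exists2 x, x \in W & (U * <[x]> != 0)%VS.
Proof.
case: (boolP (all (fun x => (U * <[x]> == 0)%VS) (vbasis W))) => [/allP all0|].
  case/negP; apply/prodv_eq0P => u v Uu /coord_vbasis ->.
  rewrite mulr_sumr big1 // => i _; rewrite -scalerAr.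
  have /all0 /prodv_eq0P UWi0 : (vbasis W)`_i \in vbasis W.
    by rewrite mem_nth ?size_tuple.
  by rewrite UWi0 ?scaler0 // memv_line.
by case/allPn => x /vbasis_mem Wx Ux _; exists x.
Qed.

Lemma subalg1 U : is_subalg U -> 1 \in U. Proof. by case/andP. Qed.
Lemma subalgM U : is_subalg U -> {in U &, forall x y, x * y \in U}.
Proof. by case/andP => _ /prodvP. Qed.

(* Brauer's lemma: a minimal left ideal L has L^2 != 0, so L = L x for some
   x in L, and any e in L with x = e x is idempotent by minimality. *)
Lemma left_ideal_idempotent U L :
  is_subalg U -> semisimple U -> (L <= U)%VS -> (U * L <= L)%VS -> L != 0%VS ->
  exists e, [/\ e \in L, e != 0 & e * e = e].
Proof.
(* Induction on the dimension stands in for the choice of a minimal [L]: if [L x] is smaller than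
   [L], or if the annihilator [N] of [x] in [L] is nonzero, the idempotent is found in that smaller
   left ideal. *)
move=> algU ssU; move: {2}(\dim L) (leqnn (\dim L)) => d.
elim: d L => [|d IHd] L dimL LU UL nzL.
  by move: nzL; rewrite -dimv_eq0 -leqn0 dimL.
(* If [L * L] vanished, [L * U] would be a two-sided ideal of square zero, hence zero, although it
   contains [L]. *)
have /prodv_neq0_line[x Lx nzLx] : (L * L != 0)%VS.
  apply: contra nzL => /eqP LL0.
  have LU0 : (L * U)%VS = 0%VS.
    apply: ssU; last first.
      exists 1%N; apply/eqP; rewrite expv2 -subv0 prodvA -(prodvA L U L).
      apply: subv_trans (_ : L * L * U <= _)%VS.
        by apply: prodvSl; apply: prodvSr.
      by rewrite LL0 prod0v subvv.
    case/andP: algU => U1 UU; apply/and3P; split.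
    - by apply: subv_trans UU; apply: prodvSl.
    - by rewrite prodvA; apply: prodvSl.
    - by rewrite -prodvA; apply: prodvSr.
  rewrite -subv0 -LU0; apply/subvP => y Ly.
  by rewrite -[y]mulr1 memv_mul // subalg1.
have LxL : (L * <[x]> <= L)%VS.
  apply: subv_trans UL; apply: subv_trans (prodvSr _ _) (prodvSl _ _) => //.
have ULx : (U * (L * <[x]>) <= L * <[x]>)%VS by rewrite prodvA; apply: prodvSl.
have [eqLx|neqLx] := eqVneq (L * <[x]>)%VS L; last first.
  have [||||e [Lxe nz_e ee]] := IHd (L * <[x]>)%VS => //.
  - rewrite -ltnS; apply: leq_trans dimL; rewrite ltn_neqAle.
    by rewrite (dimvS LxL) andbT (dimv_leqif_eq LxL).
  - exact: subv_trans LxL LU.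
  by exists e; split=> //; apply: (subvP LxL).
have /memv_cosetP[e Le xE] : x \in (L * <[x]>)%VS by rewrite eqLx.
pose N := (L :&: lker (amulr x))%VS.
have NL : (N <= L)%VS by apply: capvSl.
have memN y : (y \in N) = (y \in L) && (y * x == 0).
  by rewrite memv_cap memv_ker amulrE.
have [N0|nzN] := eqVneq N 0%VS.
  have nzx : x != 0.
    apply: contra nzLx => /eqP->; apply/prodv_eq0P => u v _.
    by case/vlineP => k ->; rewrite scaler0 mulr0.
  exists e; split=> //.
    by apply: contra nzx => /eqP e0; rewrite xE e0 mul0r.
  apply/eqP; rewrite -subr_eq0 -memv0 -N0 memN mulrBl -mulrA -!xE subrr eqxx.
  by rewrite andbT memvB // (subvP UL) // memv_mul // (subvP LU).
have UN : (U * N <= N)%VS.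
  apply/prodvP => u v Uu; rewrite !memN => /andP[Lv /eqP vx0].
  by rewrite -mulrA vx0 mulr0 eqxx andbT (subvP UL) ?memv_mul.
have [||||n [Nn nz_n nn]] := IHd N => //.
- rewrite -ltnS; apply: leq_trans dimL; rewrite ltn_neqAle.
  rewrite (dimvS NL) andbT (dimv_leqif_eq NL).
  apply: contra nzLx => /eqP eqN; apply/prodv_eq0P => u v.
  rewrite -eqN memN => /andP[_ /eqP ux0] /vlineP[k ->].
  by rewrite -scalerAr ux0 scaler0.
- exact: subv_trans NL LU.
by exists n; split=> //; apply: (subvP NL).
Qed.

(** The trace is taken on all of [A], so that a single form serves every subalgebra and can be
    compared between them. *)
Definition reg_trace x : F := lfun_trace (amull x).
Arguments reg_trace : simpl never.

Fact reg_trace_is_scalar : scalar reg_trace.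
Proof. by move=> k x y; rewrite /reg_trace !linearP. Qed.
HB.instance Definition _ :=
  GRing.isSemilinear.Build F A F _ reg_trace
    (GRing.semilinear_linear reg_trace_is_scalar).

Lemma reg_traceC x y : reg_trace (x * y) = reg_trace (y * x).
Proof. by rewrite /reg_trace !amullM; apply: lfun_traceC. Qed.

Lemma reg_trace_idempotent e : e != 0 -> e * e = e -> reg_trace e != 0.
Proof.
move=> nze ee; apply: idempotent_trace_neq0 => //.
  by apply/lfunP => y; rewrite comp_lfunE !amullE mulrA ee.
by apply: contra nze => /eqP e0; rewrite -[e]mulr1 -amullE e0 zero_lfunE.
Qed.

(** For nonzero [x] the left ideal [U x] contains a nonzero idempotent [u * x], whose trace does not
    vanish. *)
Lemma reg_trace_nondegenerate U x :
  is_subalg U -> semisimple U -> x \in U ->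
  {in U, forall y, reg_trace (y * x) = 0} -> x = 0.
Proof.
move=> algU ssU Ux tr0; apply/eqP; apply: contraT => nzx.
have [|||||e] := @left_ideal_idempotent U (U * <[x]>)%VS => //.
- apply/prodvP => u v Uu /vlineP[k ->].
  by rewrite -scalerAr memvZ // subalgM.
- by rewrite prodvA; apply: prodvSl; case/andP: algU.
- apply: contra nzx => /eqP Ux0; rewrite -memv0 -Ux0 -{1}[x]mul1r.
  by rewrite memv_mul ?memv_line ?subalg1.
case=> /memv_cosetP[u Uu ->] /reg_trace_idempotent + ee.
by rewrite tr0 // eqxx => /(_ ee).
Qed.


(** * Dual bases and Casimir sums *)

Definition ss_subalg U : Prop := is_subalg U /\ semisimple U.

Definition gram U : 'M[F]_(\dim U) :=
  \matrix_(i, j) reg_trace ((vbasis U)`_i * (vbasis U)`_j).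

Definition bas U (k : 'I_(\dim U)) : A := (vbasis U)`_k.

(* The basis dual to [vbasis U] for the form (x, y) |-> reg_trace (x * y);
   meaningful only when this form is nondegenerate on [U]. *)
Definition dual U (k : 'I_(\dim U)) : A :=
  \sum_i invmx (gram U) i k *: (vbasis U)`_i.

Lemma bas_mem U (k : 'I_(\dim U)) : bas k \in U.
Proof. by rewrite /bas vbasis_mem // mem_nth // size_tuple. Qed.

Lemma dual_mem U (k : 'I_(\dim U)) : dual k \in U.
Proof. by apply: memv_suml => i _; rewrite memvZ // bas_mem. Qed.

Section Dual.
Variable U : {vspace A}.
Hypothesis ssU : ss_subalg U.

Lemma gram_unit : gram U \in unitmx.
Proof.
rewrite -row_free_unit -kermx_eq0; apply/eqP/row_matrixP => i.
set v := row i _; have v0 : v *m gram U = 0.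
  by rewrite -row_mul mulmx_ker row0.
rewrite row0; pose x := \sum_j v 0 j *: (vbasis U)`_j.
have Ux : x \in U by apply: memv_suml => j _; rewrite memvZ // (bas_mem j).
have x0 : x = 0.
  apply: (reg_trace_nondegenerate ssU.1 ssU.2 Ux) => y Uy.
  rewrite (coord_vbasis Uy) mulr_suml linear_sum big1 //= => j _.
  rewrite -scalerAl linearZ /= /x mulr_sumr linear_sum /=.
  transitivity (coord (vbasis U) j y * (v *m gram U) 0 j).
    rewrite [(_ *m _) _ _]mxE; congr (_ * _); apply: eq_bigr => k _.
    by rewrite [gram U _ _]mxE -scalerAr linearZ /= reg_traceC.
  by rewrite v0 mxE mulr0.
apply/rowP => j; rewrite [RHS]mxE.
by rewrite -(coord_sum_free (fun k => v 0 k) j (basis_free (vbasisP U))) -/x x0 linear0.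
Qed.

Lemma bas_dual (i j : 'I_(\dim U)) : reg_trace (bas i * dual j) = (i == j)%:R.
Proof.
rewrite /dual mulr_sumr linear_sum /=.
transitivity ((gram U *m invmx (gram U)) i j); last first.
  by rewrite mulmxV ?gram_unit // mxE.
by rewrite mxE; apply: eq_bigr => k _; rewrite -scalerAr linearZ /= mxE mulrC.
Qed.

Lemma bas_expand x : x \in U -> x = \sum_(k < \dim U) reg_trace (x * dual k) *: bas k.
Proof.
move=> Ux; rewrite {1}(coord_vbasis Ux); apply: eq_bigr => k _; congr (_ *: _).
rewrite {2}(coord_vbasis Ux) mulr_suml linear_sum (bigD1 k) //=.
rewrite -scalerAl linearZ /= bas_dual eqxx mulr1 big1 ?addr0 // => i nik.
by rewrite -scalerAl linearZ /= bas_dual (negPf nik) mulr0.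
Qed.

Lemma dual_expand x : x \in U -> x = \sum_(k < \dim U) reg_trace (bas k * x) *: dual k.
Proof.
move=> Ux; apply/eqP; rewrite -subr_eq0; apply/eqP.
apply: (reg_trace_nondegenerate ssU.1 ssU.2).
  by apply: memvB => //; apply: memv_suml => k _; rewrite memvZ // dual_mem.
move=> y Uy; rewrite (coord_vbasis Uy) mulr_suml linear_sum big1 //= => j _.
rewrite -scalerAl linearZ /= mulrBr mulr_sumr linearB linear_sum /=.
rewrite (bigD1 j) //= big1 => [|i nij].
  by rewrite -scalerAr linearZ /= bas_dual eqxx mulr1 addr0 subrr mulr0.
by rewrite -scalerAr linearZ /= bas_dual eq_sym (negPf nij) mulr0.
Qed.

End Dual.

(** Expanding [T (bas k)] in the basis of [W] and [S (dual j)] in the dual basis of [U] yields the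
    same coefficients. The adjoint pairs used later are left and right multiplication, [th] with
    itself, and [even_proj] with itself or with the inclusion of the even part. *)
Lemma casimir_adjoint U W (T S f : 'End(A)) :
    ss_subalg U -> ss_subalg W ->
    {in U, forall x, T x \in W} -> {in W, forall y, S y \in U} ->
    {in U & W, forall x y, reg_trace (T x * y) = reg_trace (x * S y)} ->
  \sum_(k < \dim U) T (bas k) * f (dual k) =
  \sum_(k < \dim W) bas k * f (S (dual k)).
Proof.
move=> ssU ssW TUW SWU adj.
transitivity (\sum_(k < \dim U) \sum_(j < \dim W)
    reg_trace (bas k * S (dual j)) *: (bas j * f (dual k))).
  apply: eq_bigr => k _; rewrite {1}(bas_expand ssW (TUW _ (bas_mem k))).
  rewrite mulr_suml; apply: eq_bigr => j _.
  by rewrite adj ?bas_mem ?dual_mem // scalerAl.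
rewrite exchange_big /=; apply: eq_bigr => j _.
rewrite [in RHS](dual_expand ssU (SWU _ (dual_mem j))) [f _]linear_sum mulr_sumr.
by apply: eq_bigr => k _; rewrite linearZ scalerAr.
Qed.

Lemma casimir_mull U x f : ss_subalg U -> x \in U ->
  x * (\sum_(k < \dim U) bas k * f (dual k)) = 
  \sum_(k < \dim U) bas k * f (dual k * x).
Proof.
move=> ssU Ux; rewrite mulr_sumr.
under eq_bigr => k _ do rewrite mulrA -[x * _]amullE.
under [RHS]eq_bigr => k _ do rewrite -[_ * x]amulrE.
apply: (@casimir_adjoint U U (amull x) (amulr x) f) => // [y Uy|y Uy|y z Uy Uz].
- by rewrite amullE (subalgM ssU.1).
- by rewrite amulrE (subalgM ssU.1).
by rewrite amullE amulrE -(mulrA x) reg_traceC mulrA.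
Qed.

Definition casimir U : A := \sum_(k < \dim U) bas k * dual k.

Lemma casimir_mem U : is_subalg U -> casimir U \in U.
Proof.
by move=> aU; apply: memv_suml => k _; rewrite subalgM ?bas_mem ?dual_mem.
Qed.

Lemma casimir_comm U x : ss_subalg U -> x \in U -> x * casimir U = casimir U * x.
Proof.
move=> ssU Ux; have := casimir_mull \1%VF ssU Ux.
under eq_bigr => k _ do rewrite id_lfunE.
under [in RHS]eq_bigr => k _ do rewrite id_lfunE mulrA.
by rewrite -mulr_suml.
Qed.

(* For an idempotent e of U, reg_trace (e * casimir U) is the trace of left
   multiplication by e on U, hence nonzero. *)
Lemma casimir_regular U x :
  ss_subalg U -> x \in U -> casimir U * x = 0 -> x = 0.
Proof.
move=> ssU Ux cx0; have [aU sU] := ssU.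
pose N := (U :&: lker (amull (casimir U)))%VS.
have memN y : (y \in N) = (y \in U) && (casimir U * y == 0).
  by rewrite memv_cap memv_ker amullE.
have [N0|nzN] := eqVneq N 0%VS.
  by apply/eqP; rewrite -memv0 -N0 memN Ux cx0 eqxx.
have [|e []] := left_ideal_idempotent aU sU (capvSl _ _) _ nzN.
  apply/prodvP => u v Uu; rewrite !memN => /andP[Uv /eqP cv0].
  by rewrite subalgM // mulrA -casimir_comm // -mulrA cv0 mulr0 eqxx.
rewrite memN => /andP[Ue /eqP ce0] nze ee.
(* [P] is the orthogonal projection onto [U] for the trace form followed by left multiplication by
   [e]; it is idempotent, with trace [reg_trace (e * casimir U)]. *)
pose phi (k : 'I_(\dim U)) : {scalar A} := reg_trace \o amull (dual k).
pose P : 'End(A) := \sum_(k < \dim U) rank1_lfun (e * bas k) (phi k).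
have PE y : P y = e * \sum_(k < \dim U) reg_trace (dual k * y) *: bas k.
  rewrite sum_lfunE mulr_sumr; apply: eq_bigr => k _.
  by rewrite rank1_lfunE /= amullE scalerAr.
have PU y : y \in U -> P y = e * y.
  move=> Uy; rewrite PE {2}(bas_expand ssU Uy).
  by congr (_ * _); apply: eq_bigr => k _; rewrite reg_traceC.
have trP : lfun_trace P = 0.
  rewrite linear_sum /=.
  under eq_bigr => k _ do
    rewrite rank1_trace /= amullE reg_traceC -mulrA.
  by rewrite -linear_sum -mulr_sumr /= -/(casimir U) casimir_comm // ce0 linear0.
have PP : (P \o P)%VF = P.
  apply/lfunP => y; rewrite comp_lfunE PU; first by rewrite PE mulrA ee.
  rewrite PE subalgM //; apply: memv_suml => k _.
  by rewrite memvZ ?bas_mem.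
suff /(idempotent_trace_neq0 F0 PP) : P != 0 by rewrite trP eqxx.
by apply: contra nze => /eqP P0; rewrite -ee -PU // P0 zero_lfunE.
Qed.

(** By [casimir_regular], multiplication by the Casimir element is injective on [U], hence onto by
    dimension; regularity also makes the inverse central. *)
Lemma casimir_inv U : ss_subalg U ->
  exists s, [/\ s \in U, s \in 'C(U)%VS, s * casimir U = 1 & casimir U * s = 1].
Proof.
move=> ssU; have [aU sU] := ssU; pose L := amull (casimir U).
have LU : (L @: U)%VS = U.
  apply/eqP; rewrite eqEdim; apply/andP; split.
    apply/subvP => _ /memv_imgP[x Ux ->].
    by rewrite amullE subalgM ?casimir_mem.
  rewrite limg_dim_eq //; apply/eqP; rewrite -subv0; apply/subvP => x.
  rewrite memv_cap memv_ker amullE memv0 => /andP[Ux /eqP].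
  by move/(casimir_regular ssU Ux)->.
have /memv_imgP[s Us] : 1 \in (L @: U)%VS by rewrite LU subalg1.
rewrite amullE => sE; exists s; split=> //; last first.
  by rewrite sE -casimir_comm.
apply/centvP => x Ux; apply/eqP; rewrite -subr_eq0; apply/eqP.
apply: (casimir_regular ssU); first by rewrite memvB // subalgM.
by rewrite mulrBr !mulrA -sE mul1r -(casimir_comm ssU Ux) -mulrA -sE mulr1 subrr.
Qed.

(** The sum of the [c k] tensor [dual k] is a separability idempotent, namely the Casimir tensor
    divided by the Casimir element. Quantifying over [f] replaces the tensor product. *)
Lemma separability U : ss_subalg U ->
  exists c : 'I_(\dim U) -> A,
    [/\ forall k, c k \in U, \sum_k c k * dual k = 1 &
        forall f x, x \in U ->
        x * (\sum_k c k * f (dual k)) = \sum_k c k * f (dual k * x)].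
Proof.
move=> ssU; have [s [Us /centvP sC sc _]] := casimir_inv ssU.
exists (fun k => s * bas k); split=> [k||f x Ux].
- by rewrite (subalgM ssU.1) // bas_mem.
- by under eq_bigr => k _ do rewrite -mulrA; rewrite -mulr_sumr.
under eq_bigr => k _ do rewrite -mulrA.
under [in RHS]eq_bigr => k _ do rewrite -mulrA.
by rewrite -!mulr_sumr mulrA -sC // -mulrA casimir_mull.
Qed.

Implicit Types B D E G H : {vspace A}.

(** * Averaging and semisimplicity *)

(** The tool for killing a nilpotent ideal: each of its elements need only be fixed by right
    multiplication by some [e] in it. *)
Lemma nilpotent_fix I y e k : (I ^+ k.+1)%VS = 0%VS -> e \in I -> y * e = y -> y = 0.
Proof.
move=> I0 Ie ye; have yX m : y * e ^+ m = y.
  by elim: m => [|m IHm]; rewrite ?expr0 ?mulr1 // exprS mulrA ye.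
have eX m : e ^+ m \in (I ^+ m)%VS.
  elim: m => [|m IHm]; first by rewrite expr0 expv0 memv_line.
  by rewrite exprS expvSl memv_mul.
have := eX k.+1; rewrite I0 memv0 => /eqP e0.
by rewrite -(yX k.+1) e0 mulr0.
Qed.

(** Maschke averaging of [p]. The last clause preserves equivariance under elements commuting with
    [U], so that two commuting algebras can be averaged over in turn. *)
Lemma equivariant_proj U W p :
    ss_subalg U -> (U * W <= W)%VS ->
    (forall y, p y \in W) -> {in W, forall y, p y = y} ->
  exists q : 'End(A),
    [/\ forall y, q y \in W, {in W, forall y, q y = y},
        {in U, forall u y, q (u * y) = u * q y} &
        {in 'C(U)%VS, forall h,
          (forall y, p (h * y) = h * p y) -> forall y, q (h * y) = h * q y}].
Proof.
move=> ssU /prodvP UW pW pid; have [c [cU c1 cE]] := separability ssU.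
exists (\sum_k (amull (c k) \o (p \o amull (dual k))))%VF.
set q := (\sum_k _)%VF.
have qE y : q y = \sum_k c k * p (dual k * y).
  by rewrite sum_lfunE; apply: eq_bigr => k _; rewrite !comp_lfunE !amullE.
split=> [y|y Wy|u Uu y|h /centvP hC ph y]; rewrite !qE.
- by apply: memv_suml => k _; rewrite UW.
- under eq_bigr => k _ do rewrite pid ?UW ?dual_mem // mulrA.
  by rewrite -mulr_suml c1 mul1r.
- have := cE (p \o amulr y)%VF u Uu.
  under eq_bigr => k _ do rewrite comp_lfunE amulrE.
  under [in RHS]eq_bigr => k _ do rewrite comp_lfunE amulrE -mulrA.
  by [].
rewrite mulr_sumr; apply: eq_bigr => k _.
by rewrite !mulrA (hC _ (cU k)) -(hC _ (dual_mem k)) -mulrA ph mulrA.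
Qed.

Lemma equivariant_projv U W : ss_subalg U -> (U * W <= W)%VS ->
  exists q : 'End(A),
    [/\ forall y, q y \in W, {in W, forall y, q y = y} &
        {in U, forall u y, q (u * y) = u * q y}].
Proof.
move=> ssU UW; have [] := @equivariant_proj U W (projv W) ssU UW.
- exact: memv_proj.
- exact: projv_id.
by move=> q [qW qid qU _]; exists q.
Qed.

(** [r] sends [y] to the sum of the [c k * y * dual k]. Its linearity on both sides over the
    centraliser is what [retract_semisimple] asks for. *)
Lemma cent_avg U : ss_subalg U -> exists r : 'End(A),
  [/\ forall y, r y \in 'C(U)%VS, {in 'C(U)%VS, forall y, r y = y},
      {in 'C(U)%VS, forall h y, r (h * y) = h * r y /\ r (y * h) = r y * h} &
      forall W, is_subalg W -> (U <= W)%VS -> {in W, forall y, r y \in W}].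
Proof.
move=> ssU; have [c [cU c1 cE]] := separability ssU.
exists (\sum_k (amull (c k) \o amulr (dual k)))%VF.
set r := (\sum_k _)%VF.
have rE y : r y = \sum_k c k * (y * dual k).
  by rewrite sum_lfunE; apply: eq_bigr => k _; rewrite comp_lfunE amullE amulrE.
split=> [y|y /centvP yC|h /centvP hC y|W aW UW y Wy].
- apply/centvP => u Uu; rewrite rE.
  under eq_bigr => k _ do rewrite -[y * _]amullE.
  rewrite cE // mulr_suml; apply: eq_bigr => k _.
  by rewrite !amullE !mulrA.
- rewrite rE; under eq_bigr => k _ do rewrite (yC _ (dual_mem k)) mulrA.
  by rewrite -mulr_suml c1 mul1r.
- rewrite !rE mulr_sumr mulr_suml; split; apply: eq_bigr => k _.
    by rewrite !mulrA (hC _ (cU k)).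
  by rewrite -!mulrA (hC _ (dual_mem k)).
rewrite rE; apply: memv_suml => k _.
by rewrite !subalgM // (subvP UW) ?dual_mem.
Qed.

(** For a nilpotent ideal [I] of [D], a [B]-linear projection [q] onto [B * I] gives [y = y * q 1]
    for [y] in [I]. Applying [r] gives [y = y * r (q 1)] with [r (q 1)] in [I], so [y = 0]. *)
Lemma retract_semisimple B D (r : 'End(A)) :
    ss_subalg B -> is_subalg D -> (D <= B)%VS ->
    {in B, forall y, r y \in D} -> {in D, forall y, r y = y} ->
    {in D & B, forall x y, r (x * y) = x * r y} ->
    {in B & D, forall x y, r (x * y) = r x * y} ->
  ss_subalg D.
Proof.
move=> ssB aD DB rBD rid rl rr; split=> // I /and3P[ID /prodvP DI _] [k I0].
apply/eqP; rewrite -subv0; apply/subvP => y Iy; rewrite memv0; apply/eqP.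
have [|q [qW qid qB]] := @equivariant_projv B (B * I)%VS ssB.
  by rewrite prodvA; apply: prodvSl; case/andP: ssB.1.
have BIB : (B * I <= B)%VS.
  apply/prodvP => b i Bb Ii; apply: (subalgM ssB.1) => //.
  by rewrite (subvP DB) // (subvP ID).
have rBI : (r @: (B * I) <= I)%VS.
  apply/subvP => _ /memv_imgP[x + ->]; rewrite memv_preim.
  apply: subvP x; apply/prodvP => b i Bb Ii.
  by rewrite -memv_preim rr ?(subvP ID) // DI // rBD.
have Dy := subvP ID _ Iy; have By := subvP DB _ Dy.
apply: (nilpotent_fix I0 (subvP rBI _ (memv_img r (qW 1)))).
rewrite -rl //; last by rewrite (subvP BIB).
rewrite -qB // mulr1 qid ?rid // -[y]mul1r memv_mul //.
exact: subalg1 ssB.1.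
Qed.

Lemma subalg_cent_cap E U : is_subalg E -> is_subalg (E :&: 'C(U))%VS.
Proof.
move=> aE; apply/andP; split; first by rewrite memv_cap subalg1 ?centv1.
apply/prodvP => x y; rewrite !memv_cap => /andP[Ex Cx] /andP[Ey Cy].
by rewrite subalgM //= (memvM (A := 'C(U)%AS)).
Qed.

Lemma center_ss E : ss_subalg E -> ss_subalg 'Z(E)%VS.
Proof.
move=> ssE; have [r [rC rid rlin rW]] := cent_avg ssE.
have ZC x : x \in 'Z(E)%VS -> x \in 'C(E)%VS by case/memv_capP.
apply: (@retract_semisimple E _ r) => //.
- exact: subalg_cent_cap ssE.1.
- exact: capvSl.
- by move=> y Ey; rewrite memv_cap rC (rW _ ssE.1 (subvv E)).
- by move=> y /ZC/rid.
- by move=> x y /ZC/rlin/(_ y)[].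
by move=> x y _ /ZC/rlin/(_ x)[].
Qed.

Lemma prodv_comm G H : (H <= 'C(G))%VS -> (H * G <= G * H)%VS.
Proof.
by move/centvsP => HG; apply/prodvP => h g Hh Gg; rewrite HG // memv_mul.
Qed.

Lemma prod_subalg G H : is_subalg G -> is_subalg H -> (H <= 'C(G))%VS ->
  is_subalg (G * H)%VS.
Proof.
move=> aG aH HG; apply/andP; split.
  by rewrite -[1]mul1r memv_mul // subalg1.
rewrite -prodvA (prodvA H); apply: subv_trans (prodvSr G (prodvSl H (prodv_comm HG))) _.
rewrite -(prodvA G H H) prodvA; case/andP: aG => _ GG; case/andP: aH => _ HH.
exact: prodvS.
Qed.

(** Averaging over [H] and then over [G] gives a projection onto a nilpotent ideal that is linear
    over both, hence right multiplication by an element of that ideal. *)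
Lemma prod_ss G H : ss_subalg G -> ss_subalg H -> (H <= 'C(G))%VS ->
  ss_subalg (G * H)%VS.
Proof.
move=> ssG ssH HG; have aGH := prod_subalg ssG.1 ssH.1 HG.
split=> // I /and3P[IGH GHI _] [k I0].
have GI : (G * I <= I)%VS.
  apply: subv_trans GHI; apply: prodvSl; apply/subvP => g Gg.
  by rewrite -[g]mulr1 memv_mul // (subalg1 ssH.1).
have HI : (H * I <= I)%VS.
  apply: subv_trans GHI; apply: prodvSl; apply/subvP => h Hh.
  by rewrite -[h]mul1r memv_mul // (subalg1 ssG.1).
have [p [pI pid pH]] := equivariant_projv ssH HI.
have [q [qI qid qG qC]] := equivariant_proj ssG GI pI pid.
have qH h : h \in H -> forall y, q (h * y) = h * q y.
  by move=> Hh; apply: qC; rewrite ?(subvP HG) //; apply: pH.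
have qGH : (G * H <= lker (q - amulr (q 1%R)))%VS.
  apply/prodvP => g h Gg Hh; apply/eqlfunP.
  by rewrite qG // -{1}[h]mulr1 qH // amulrE mulrA.
apply/eqP; rewrite -subv0; apply/subvP => y Iy; rewrite memv0; apply/eqP.
apply: (nilpotent_fix I0 (qI 1)).
by have /eqlfunP := subvP qGH _ (subvP IGH _ Iy); rewrite amulrE (qid y Iy) => <-.
Qed.

(** Averaging over [U] fixes [x] and sends [d * h] to [r d * h], since [H] commutes with [U]. *)
Lemma cent_cap_prod U D H x :
  ss_subalg U -> is_subalg D -> (U <= D)%VS -> (H <= 'C(U))%VS ->
  x \in (D * H)%VS -> x \in 'C(U)%VS -> x \in ((D :&: 'C(U)) * H)%VS.
Proof.
move=> ssU aD UD HU DHx Cx; have [r [rC rid rlin rW]] := cent_avg ssU.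
rewrite -(rid x Cx) memv_preim; apply: subvP DHx; apply/prodvP => d h Dd Hh.
rewrite -memv_preim; have [_ ->] := rlin h (subvP HU _ Hh) d.
by rewrite memv_mul // memv_cap rC (rW _ aD UD).
Qed.

(** * The double centraliser theorem *)

Lemma casimir_sym U : ss_subalg U -> \sum_(k < \dim U) dual k * bas k = casimir U.
Proof.
move=> ssU; rewrite /casimir.
under eq_bigr => k _ do
  rewrite {1}(dual_expand ssU (bas_mem k)) mulr_sumr.
rewrite exchange_big /=; apply: eq_bigr => j _.
rewrite [X in X * _](dual_expand ssU (bas_mem j)) mulr_suml.
by apply: eq_bigr => k _; rewrite -scalerAl -scalerAr reg_traceC.
Qed.

(* On a semisimple E the averaging map onto the centre is, up to a central
   unit, the orthogonal projection for the trace form; this turns the rank-one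
   maps y |-> reg_trace (y * v) *: u, once averaged over 'Z(E), into sums of
   maps y |-> a * y * b. *)
Lemma center_linear_sandwich E f :
    ss_subalg E -> {in E, forall y, f y \in E} ->
    {in 'Z(E)%VS & E, forall z y, f (z * y) = z * f y} ->
  exists (K : finType) (a b : K -> A),
    [/\ forall k, a k \in E, forall k, b k \in E &
        {in E, forall y, f y = \sum_k a k * y * b k}].
Proof.
move=> ssE fE fZ; have ssZ := center_ss ssE; have aE := ssE.1.
have ZE z : z \in 'Z(E)%VS -> z \in E by case/memv_capP.
have [w [Ew /centvP wC wc _]] := casimir_inv ssE.
have [v [/ZE Ev _ vc _]] := casimir_inv ssZ.
(* The left side is the orthogonal projection of [x] onto the center. The right side is central and
   has the same trace pairing with every central element, [w] cancelling the Casimir element. *)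
have avg x : x \in E -> \sum_(k < \dim 'Z(E)) reg_trace (x * dual k) *: bas k =
    \sum_(j < \dim E) bas j * (x * w) * dual j.
  move=> Ex; set t := RHS; have tZ : t \in 'Z(E)%VS.
    rewrite memv_cap; apply/andP; split.
      by apply: memv_suml => j _; rewrite !subalgM ?bas_mem ?dual_mem.
    have tE : t = \sum_(j < \dim E) bas j * amull (x * w) (dual j).
      by apply: eq_bigr => j _; rewrite amullE !mulrA.
    apply/centvP => u Eu; rewrite tE casimir_mull // mulr_suml.
    by apply: eq_bigr => j _; rewrite !amullE !mulrA.
  rewrite (bas_expand ssZ tZ); apply: eq_bigr => k _; congr (_ *: _).
  set z : A := dual k; have /memv_capP[Ez /centvP zC] : z \in 'Z(E)%VS.
    exact: dual_mem.
  have -> : x * z = x * w * z * casimir E.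
    by rewrite -mulrA zC ?casimir_mem // -!mulrA (mulrA w) wc mul1r.
  rewrite -(casimir_sym ssE) mulr_sumr mulr_suml !linear_sum /=.
  apply: eq_bigr => j _; rewrite -!mulrA [RHS]reg_traceC -!mulrA.
  by rewrite (mulrA (dual j) z) -(zC _ (dual_mem j)) -!mulrA.
exists ('I_(\dim E) * 'I_(\dim E))%type.
exists (fun k => v * bas k.2), (fun k => dual k.1 * w * dual k.2 * f (bas k.1)).
split=> [k|k|y Ey].
- by rewrite subalgM ?bas_mem.
- by rewrite !subalgM ?dual_mem ?fE ?bas_mem.
rewrite -[f y]mul1r -vc -mulrA /casimir mulr_suml.
(* Central linearity moves [dual k] inside [f], where [dual k * y] is expanded in the basis of [E];
   summing over [k] then gives the left side of [avg] at [y * dual i]. *)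
have fexp (k : 'I_(\dim 'Z(E))) : bas k * dual k * f y = \sum_(i < \dim E)
    (reg_trace (y * dual i * dual k) *: bas k) * f (bas i) :> A.
  have Zk : dual k \in 'Z(E)%VS := dual_mem k.
  rewrite -mulrA -fZ // [in f _](bas_expand ssE (subalgM aE (ZE _ Zk) Ey)).
  rewrite linear_sum mulr_sumr; apply: eq_bigr => i _.
  by rewrite linearZ -scalerAr -scalerAl -!mulrA reg_traceC mulrA.
rewrite (eq_bigr _ (fun k _ => fexp k)) exchange_big /= mulr_sumr.
rewrite -(pair_bigA _ (fun i j => v * bas j * y * (dual i * w * dual j * f (bas i)))) /=.
apply: eq_bigr => i _; rewrite -mulr_suml avg; last by rewrite subalgM ?dual_mem.
rewrite mulr_suml mulr_sumr; apply: eq_bigr => j _.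
by rewrite !mulrA.
Qed.

(* Double centraliser theorem for D in E: a projection q of E onto D * 'Z(E)
   that is linear over D and over 'Z(E) has the form y |-> \sum_k c_k y b_k
   with c_k in the centraliser of D, so q fixes every x commuting with the c_k. *)
Lemma double_centraliser D E x :
    ss_subalg D -> ss_subalg E -> (D <= E)%VS ->
    x \in E -> x \in 'C(E :&: 'C(D))%VS -> x \in (D * 'Z(E))%VS.
Proof.
move=> ssD ssE DE Ex /centvP xK; have aE := ssE.1; have ssZ := center_ss ssE.
set W := (D * 'Z(E))%VS.
have WE : (W <= E)%VS.
  apply/prodvP => d z Dd /memv_capP[Ez _]; apply: (subalgM aE) => //.
  exact: subvP DE _ Dd.
have ZD : ('Z(E) <= 'C(D))%VS.
  apply/centvsP => z d /memv_capP[_ /centvP zC] Dd; apply: zC.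
  exact: subvP DE _ Dd.
have ZW : ('Z(E) * W <= W)%VS.
  rewrite prodvA; apply: subv_trans (prodvSl _ (prodv_comm ZD)) _.
  by rewrite -prodvA; apply: prodvSr; case/andP: ssZ.1.
have DW : (D * W <= W)%VS by rewrite prodvA; apply: prodvSl; case/andP: ssD.1.
have [p [pW pid pZ]] := equivariant_projv ssZ ZW.
have [q [qW qid qD qC]] := equivariant_proj ssD DW pW pid.
have qZ z : z \in 'Z(E)%VS -> forall y, q (z * y) = z * q y.
  by move=> Zz; apply: qC; [apply: subvP ZD _ Zz | apply: pZ].
have [|z y Zz _|K [a [b [aK bK qE]]]] := @center_linear_sandwich E q ssE.
- by move=> y _; apply: (subvP WE).
- exact: qZ.
have [c [cD c1 cE]] := separability ssD.
(* Averaging over [D] turns the coefficient [a l] into an element of the centraliser; the formula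
   for [q] survives because [q] is [D]-linear. *)
pose k l := \sum_i c i * (a l * dual i).
have DE' d : d \in D -> d \in E by apply: subvP.
have kK l : k l \in (E :&: 'C(D))%VS.
  rewrite memv_cap; apply/andP; split.
    by apply: memv_suml => i _; rewrite !(subalgM aE) ?aK ?(DE' _ (cD i)) ?(DE' _ (dual_mem i)).
  apply/centvP => u Du; rewrite /k.
  under eq_bigr => i _ do rewrite -[a l * _]amullE.
  rewrite cE // mulr_suml; apply: eq_bigr => i _.
  by rewrite !amullE !mulrA.
have qk y : y \in E -> q y = \sum_l k l * y * b l.
  move=> Ey; rewrite -[q y]mul1r -c1 mulr_suml.
  transitivity (\sum_i \sum_l c i * (a l * dual i) * y * b l).
    apply: eq_bigr => i _; rewrite -mulrA -qD ?dual_mem // qE.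
      by rewrite mulr_sumr; apply: eq_bigr => l _; rewrite !mulrA.
    by rewrite (subalgM aE) ?(DE' _ (dual_mem i)).
  by rewrite exchange_big /=; apply: eq_bigr => l _; rewrite !mulr_suml.
have q1 : q 1 = 1.
  by rewrite qid // -[1]mul1r memv_mul ?(subalg1 ssD.1) ?(subalg1 ssZ.1).
have -> : x = q x; last exact: qW.
rewrite qk // -{1}[x]mulr1 -q1 qk ?(subalg1 aE) // mulr_sumr.
by apply: eq_bigr => l _; rewrite mulr1 !mulrA xK.
Qed.

(** * Graded algebras and graded centers *)

Section Graded.
Variable th : 'AEnd(A).
Hypothesis thK : forall x, th (th x) = x.

Lemma parityM x y : th (x * y) = th x * th y. Proof. exact: rmorphM. Qed.

(** Left multiplication by [th x] is the conjugate under [th] of left multiplication by [x]. *)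
Lemma reg_trace_parity x : reg_trace (th x) = reg_trace x.
Proof.
have -> : reg_trace (th x) = lfun_trace (th \o (amull x \o th))%VF.
  congr lfun_trace; apply/lfunP => y.
  by rewrite !comp_lfunE !amullE parityM thK.
rewrite lfun_traceC; congr lfun_trace; apply/lfunP => y.
by rewrite !comp_lfunE thK.
Qed.

Lemma char0_half : (2%:R^-1 : F) + 2%:R^-1 = 1.
Proof.
have n2 : (2%:R : F) != 0 by rewrite ((pcharf0P _).1 F0).
by rewrite -mulr2n -(mulr_natl 2%:R^-1) mulfV.
Qed.

Definition even_proj : 'End(A) := 2%:R^-1 *: (\1%VF + th).

Lemma even_projE x : even_proj x = 2%:R^-1 *: (x + th x).
Proof. by rewrite scale_lfunE add_lfunE id_lfunE. Qed.

Lemma parity_even_proj x : th (even_proj x) = even_proj x.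
Proof. by rewrite even_projE linearZ linearD /= thK addrC. Qed.

Lemma even_proj_id x : th x = x -> even_proj x = x.
Proof. by move=> ex; rewrite even_projE ex scalerDr -scalerDl char0_half scale1r. Qed.

Lemma even_projMl x y : th x = x -> even_proj (x * y) = x * even_proj y.
Proof. by move=> ex; rewrite !even_projE parityM ex -mulrDr scalerAr. Qed.

Lemma even_projMr x y : th y = y -> even_proj (x * y) = even_proj x * y.
Proof. by move=> ey; rewrite !even_projE parityM ey -mulrDl scalerAl. Qed.

Lemma even_proj_parity x : even_proj (th x) = even_proj x.
Proof. by rewrite !even_projE thK addrC. Qed.

Lemma even_partP U x : reflect (x \in U /\ th x = x) (x \in even_part th U).
Proof.
rewrite memv_cap; apply: (iffP andP) => [[Ux /fixedSpaceP]|[Ux ex]] //.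
by split=> //; apply/fixedSpaceP.
Qed.

Lemma parity_stableP U : reflect {in U, forall x, th x \in U} (th @: U <= U)%VS.
Proof.
apply: (iffP subvP) => [sU x Ux|sU _ /memv_imgP[x Ux ->]]; last exact: sU.
by rewrite sU // memv_img.
Qed.

Lemma even_proj_mem U x : (th @: U <= U)%VS -> x \in U -> even_proj x \in U.
Proof. by move/parity_stableP => sU Ux; rewrite even_projE memvZ ?memvD ?sU. Qed.

Section SemisimpleGraded.
Variable B : {vspace A}.
Hypotheses (gB : graded_subalg th B) (sB : semisimple B).
Let ssB : ss_subalg B. Proof. by case/andP: gB. Qed.
Let thB : (th @: B <= B)%VS. Proof. by case/andP: gB. Qed.
Local Notation B0 := (even_part th B).

Lemma even_subalg : is_subalg B0.
Proof.
apply/andP; split.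
  by apply/even_partP; rewrite (subalg1 ssB.1) rmorph1.
apply/prodvP => x y /even_partP[Bx ex] /even_partP[By ey]; apply/even_partP.
by rewrite parityM ex ey (subalgM ssB.1).
Qed.

Lemma even_ss : ss_subalg B0.
Proof.
apply: (retract_semisimple (r := even_proj) ssB even_subalg (capvSl _ _)).
- move=> y By; apply/even_partP.
  by rewrite parity_even_proj even_proj_mem.
- by move=> y /even_partP[_ /even_proj_id].
- by move=> x y /even_partP[_ ex] _; apply: even_projMl.
by move=> x y _ /even_partP[_ ey]; apply: even_projMr.
Qed.

Lemma casimir_parity f :
  \sum_(k < \dim B) th (bas k) * f (dual k) =
  \sum_(k < \dim B) bas k * f (th (dual k)).
Proof.
apply: casimir_adjoint => // [||x y Bx By]; try exact/parity_stableP.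
by rewrite -reg_trace_parity parityM thK.
Qed.

(** [even_proj] is self-adjoint, and as a map onto the even part it is adjoint to the inclusion; so
    averaging over [B] with even dual vectors is averaging over [B0]. *)
Lemma casimir_even f :
  \sum_(k < \dim B) bas k * f (even_proj (dual k)) =
  \sum_(k < \dim B0) bas k * f (dual k).
Proof.
have adj x y : reg_trace (even_proj x * y) = reg_trace (x * even_proj y).
  rewrite !even_projE -scalerAl -scalerAr !linearZ /= mulrDl mulrDr !linearD /=.
  by rewrite -[reg_trace (th x * y)]reg_trace_parity parityM thK.
transitivity (\sum_(k < \dim B) even_proj (bas k) * f (dual k)).
  by symmetry; apply: casimir_adjoint => // x Bx; apply: even_proj_mem.
under [RHS]eq_bigr => k _ do rewrite -[dual k]id_lfunE.
apply: casimir_adjoint => //; first exact: even_ss.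
- move=> x Bx; apply/even_partP.
  by rewrite parity_even_proj even_proj_mem.
- by move=> y /even_partP[By _]; rewrite id_lfunE.
by move=> x y _ /even_partP[_ ey]; rewrite adj id_lfunE even_proj_id.
Qed.

Lemma twisted_centraliserP x :
  reflect {in B, forall b, x * b = th b * x} (x \in twisted_centraliser th B).
Proof.
apply: (iffP subv_bigcapP) => [xC b /coord_vbasis ->|xC i _].
  rewrite linear_sum mulr_sumr mulr_suml; apply: eq_bigr => i _ /=.
  rewrite linearZ /= -scalerAr -scalerAl; congr (_ *: _).
  have /eqlfunP := xC i isT; rewrite amulrE amullE.
  by rewrite (tnth_nth 0).
by apply/eqlfunP; rewrite amulrE amullE xC // vbasis_mem ?mem_tnth.
Qed.

(* For even z, the sums of b_k z b^k and of b_k z th(b^k) over dual bases of B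
   are central and twisted central respectively; their sum is 2 z times the
   Casimir element of the even part, which is a unit. *)
Lemma graded_center_even : graded_center th B = 'Z(B0)%VS.
Proof.
apply/eqP; rewrite eqEsubv; apply/andP; split.
  rewrite subv_add; apply/andP; split; apply/subvP => x /memv_capP[B0x xC].
    rewrite memv_cap B0x; apply/centvP => b /even_partP[Bb _].
    exact: (centvP xC).
  rewrite memv_cap B0x; apply/centvP => b /even_partP[Bb eb].
  by rewrite (twisted_centraliserP _ xC) // eb.
have [u [B0u uC uc _]] := casimir_inv even_ss.
apply/subvP => z0 Zz0.
(* The Casimir element of [B0] is divided out in advance, because the averages below multiply by
   it. *)
have [z [Zz z0E]] : exists z, z \in 'Z(B0)%VS /\ z0 = z * casimir B0.
  exists (z0 * u); rewrite -mulrA uc mulr1; split=> //.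
  apply: (subalgM (center_ss even_ss).1) => //.
  by rewrite memv_cap B0u.
have /memv_capP[/even_partP[Bz ez] /centvP zC] := Zz.
pose c := \sum_(k < \dim B) bas k * amull z (dual k).
pose t := \sum_(k < \dim B) bas k * (amull z \o th)%VF (dual k).
have Bc : c \in B.
  apply: memv_suml => k _; rewrite amullE.
  by rewrite !(subalgM ssB.1) ?bas_mem ?dual_mem.
have Bt : t \in B.
  apply: memv_suml => k _; rewrite comp_lfunE amullE.
  by rewrite !(subalgM ssB.1) ?bas_mem ?(parity_stableP _ thB) ?dual_mem.
have ec : th c = c.
  transitivity (\sum_(k < \dim B) th (bas k) * (amull z \o th)%VF (dual k)).
    rewrite /c linear_sum; apply: eq_bigr => k _ /=.
    by rewrite parityM comp_lfunE !amullE parityM ez.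
  by rewrite casimir_parity; apply: eq_bigr => k _; rewrite comp_lfunE thK.
have et : th t = t.
  transitivity (\sum_(k < \dim B) th (bas k) * amull z (dual k)).
    rewrite /t linear_sum; apply: eq_bigr => k _ /=.
    by rewrite parityM comp_lfunE !amullE parityM ez thK.
  by rewrite casimir_parity; apply: eq_bigr => k _; rewrite comp_lfunE.
have cC : c \in 'C(B)%VS.
  apply/centvP => b Bb; rewrite casimir_mull // mulr_suml.
  by apply: eq_bigr => k _; rewrite !amullE !mulrA.
have tC : t \in twisted_centraliser th B.
  apply/twisted_centraliserP => b Bb.
  rewrite casimir_mull //; last exact: (parity_stableP _ thB).
  rewrite mulr_suml; apply: eq_bigr => k _.
  by rewrite !comp_lfunE parityM thK !amullE !mulrA.
have ct : z0 = 2%:R^-1 *: c + 2%:R^-1 *: t.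
  rewrite -scalerDr /c /t -big_split scaler_sumr /=.
  transitivity (\sum_(k < \dim B) bas k * amull z (even_proj (dual k))).
    rewrite casimir_even.
    under eq_bigr => k _ do rewrite amullE zC ?dual_mem // mulrA.
    rewrite -mulr_suml -/(casimir _) -(casimir_comm even_ss) //.
    by case/memv_capP: Zz.
  apply: eq_bigr => k _.
  by rewrite even_projE !comp_lfunE !amullE -mulrDr -mulrDr -!scalerAr.
rewrite ct memv_add // memvZ // memv_cap ?cC ?tC andbT; exact/even_partP.
Qed.

(** Graded submodules of [A] under left multiplication, with [th] as grading operator; the branching
    argument finds all its modules among these. *)
Definition gsub W := (B * W <= W)%VS && (th @: W <= W)%VS.

Definition gsimple W : Prop :=
  [/\ gsub W, W != 0%VS &
      forall S, (S <= W)%VS -> gsub S -> S = 0%VS \/ S = W].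

(** Graded Maschke theorem: averaging a [B]-linear projection with its conjugate under [th] makes
    its kernel graded. *)
Lemma gsub_complement S X : gsub S -> gsub X -> (S <= X)%VS ->
  exists T, [/\ gsub T, (T <= X)%VS, (S + T = X)%VS & (S :&: T = 0)%VS].
Proof.
case/andP => BS thS /andP[BX thX] SX.
have [q [qS qid qB]] := equivariant_projv ssB BS.
pose p : 'End(A) := 2%:R^-1 *: (q + (th \o (q \o th)))%VF.
have pE y : p y = 2%:R^-1 *: (q y + th (q (th y))).
  by rewrite scale_lfunE add_lfunE !comp_lfunE.
have pS y : p y \in S.
  by rewrite pE memvZ // memvD // (parity_stableP _ thS).
have pid y : y \in S -> p y = y.
  move=> Sy; rewrite pE !qid ?(parity_stableP _ thS) // thK.
  by rewrite scalerDr -scalerDl char0_half scale1r.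
have pB b y : b \in B -> p (b * y) = b * p y.
  move=> Bb; rewrite !pE parityM !qB ?(parity_stableP _ thB) // parityM thK.
  by rewrite -mulrDr scalerAr.
have pth y : p (th y) = th (p y).
  by rewrite !pE thK [RHS]linearZ /= [th (_ + _)]linearD /= thK addrC.
exists (X :&: lker p)%VS; split.
- apply/andP; split.
    apply/prodvP => b y Bb; rewrite !memv_cap !memv_ker => /andP[Xy /eqP py0].
    by rewrite pB // py0 mulr0 eqxx andbT (prodvP BX).
  apply/parity_stableP => y; rewrite !memv_cap !memv_ker => /andP[Xy /eqP py0].
  by rewrite pth py0 linear0 eqxx andbT (parity_stableP _ thX).
- exact: capvSl.
- apply/eqP; rewrite eqEsubv subv_add SX capvSl /=; apply/subvP => x Xx.
  rewrite -[x](subrK (p x)) addrC memv_add // memv_cap memv_ker.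
  by rewrite linearB /= (pid _ (pS x)) subrr eqxx andbT memvB // (subvP SX).
apply/eqP; rewrite -subv0; apply/subvP => y.
rewrite !memv_cap memv_ker memv0 => /and3P[Sy _].
by rewrite pid.
Qed.

(** Complete reducibility: an [X] of least dimension outside [N] is simple, as otherwise it is the
    sum of two smaller submodules inside [N]. Taking a kernel for [N] lets an identity be tested on
    simple submodules. *)
Lemma gsub_sum_simple N X : gsub X ->
  (forall S, (S <= X)%VS -> gsimple S -> (S <= N)%VS) -> (X <= N)%VS.
Proof.
move: {2}(\dim X) (leqnn (\dim X)) => d; elim: d X => [|d IHd] X dX gX simN.
  by move: dX; rewrite leqn0 dimv_eq0 => /eqP ->; apply: sub0v.
have IH S : (S <= X)%VS -> S != X -> gsub S -> (S <= N)%VS.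
  move=> SX neqSX gS; apply: IHd => // [|S' S'S]; last first.
    by apply: simN; apply: subv_trans SX.
  rewrite -ltnS; apply: leq_trans dX; rewrite ltn_neqAle dimvS // andbT.
  by rewrite (dimv_leqif_eq SX).
apply: contraT => nXN; rewrite -(negPf nXN); apply: simN (subvv _) _.
split=> // [|S SX gS].
  by apply: contraNneq nXN => ->; apply: sub0v.
have [->|nzS] := eqVneq S 0%VS; first by left.
have [->|neqSX] := eqVneq S X; first by right.
have [T [gT TX STX ST0]] := gsub_complement gS gX SX.
case/negP: nXN; rewrite -STX subv_add !IH //.
apply: contraNneq nzS => TX'; move: ST0; rewrite TX'.
by move/capv_idPl: SX => -> ->.
Qed.

End SemisimpleGraded.

(** * Branching *)

(** Passes from subspaces of [A] to the module types over which the branching hypothesis quantifies;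
    it is a true restriction only when [f] maps [U] into [V]. *)
Definition restr_hom (U V : {vspace A}) f : 'Hom(subvs_of U, subvs_of V) :=
  locked (linfun (vsproj V) \o (f \o linfun vsval))%VF.

Lemma restr_homE (U V : {vspace A}) f u : f (vsval u) \in V ->
  vsval (restr_hom U V f u) = f (vsval u).
Proof. by move=> fuV; rewrite /restr_hom -lock !comp_lfunE !lfunE /= vsprojK. Qed.

Lemma restr_hom_linear U V k f g :
  restr_hom U V (k *: f + g) = k *: restr_hom U V f + restr_hom U V g.
Proof.
by rewrite /restr_hom -!lock comp_lfunDl comp_lfunDr -comp_lfunZl -comp_lfunZr.
Qed.

Lemma gsimple_module B W : graded_subalg th B -> gsimple B W ->
  simple_gmodule th B (fun a => restr_hom W W (amull a)) (restr_hom W W th).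
Proof.
case/andP=> aB thB [/andP[/prodvP BW /parity_stableP thW] nzW simW].
have rE a (u : subvs_of W) : a \in B ->
    vsval (restr_hom W W (amull a) u) = a * vsval u.
  by move=> Ba; rewrite restr_homE amullE // BW // subvsP.
have JE (u : subvs_of W) : vsval (restr_hom W W th u) = th (vsval u).
  by rewrite restr_homE // thW // subvsP.
split.
- split.
  + apply/lfunP => u; apply: val_inj.
    by rewrite /= rE ?(subalg1 aB) // id_lfunE mul1r.
  + by move=> k a b _ _; rewrite linearP restr_hom_linear.
  + move=> a b Ba Bb; apply/lfunP => u; apply: val_inj.
    by rewrite comp_lfunE /= !rE ?(subalgM aB) // mulrA.
  + apply/lfunP => u; apply: val_inj.
    by rewrite comp_lfunE /= !JE thK id_lfunE.
  move=> a Ba; apply/lfunP => u; apply: val_inj; rewrite !comp_lfunE /=.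
  by rewrite JE !rE ?(parity_stableP _ thB) // JE parityM thK.
- apply: contraNneq nzW => full0; rewrite -subv0; apply/subvP => x Wx.
  have := memvf (vsproj W x); rewrite full0 !memv0 => /eqP x0.
  by rewrite -(vsprojK Wx) x0.
move=> W' [BW' thW']; pose i : 'Hom(subvs_of W, A) := linfun vsval.
have iE u : i u = vsval u by rewrite lfunE.
have [||iW0|iW] := simW (i @: W')%VS.
- by apply/subvP => _ /memv_imgP[u _ ->]; rewrite iE subvsP.
- apply/andP; split.
    apply/prodvP => b _ Bb /memv_imgP[u W'u ->]; rewrite iE -rE // -iE.
    by rewrite memv_img // (subvP (BW' _ Bb)) // memv_img.
  apply/parity_stableP => _ /memv_imgP[u W'u ->]; rewrite iE -JE -iE.
  by rewrite memv_img // (subvP thW') // memv_img.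
- left; apply/eqP; rewrite -subv0; apply/subvP => u W'u; rewrite memv0.
  have := memv_img i W'u; rewrite iW0 memv0 iE => /eqP u0.
  by apply/eqP; apply: val_inj; rewrite /= u0.
right; apply/eqP; rewrite eqEsubv subvf /=; apply/subvP => u _.
have : vsval u \in (i @: W')%VS by rewrite iW subvsP.
by case/memv_imgP => v W'v; rewrite iE => /val_inj ->.
Qed.

(** The bound of one on the dimension of GHom, phrased so that no space of graded homomorphisms has
    to be formed. *)
Definition multiplicity_free (M N : {vspace A}) : Prop :=
  forall (U V : vectType F) (rhoU : A -> 'End(U)) (JU : 'End(U))
         (rhoV : A -> 'End(V)) (JV : 'End(V)),
    simple_gmodule th M rhoU JU -> simple_gmodule th N rhoV JV ->
  forall f g : 'Hom(U, V),
    is_ghom M rhoU JU rhoV JV f -> is_ghom M rhoU JU rhoV JV g ->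
  ~~ free [:: f; g].

Section Branching.
Variables M N : {vspace A}.
Hypotheses (gM : graded_subalg th M) (sM : semisimple M).
Hypotheses (gN : graded_subalg th N) (sN : semisimple N).
Hypotheses (MN : (M <= N)%VS) (mfMN : multiplicity_free M N).

(** The inclusion of [U] in [V] is itself a nonzero graded homomorphism, so [f] is proportional to
    it. *)
Lemma multiplicity_free_scalar U V f :
    gsimple M U -> gsimple N V -> (U <= V)%VS ->
    {in U, forall u, f u \in V} ->
    {in M & U, forall a u, f (a * u) = a * f u} ->
    {in U, forall u, f (th u) = th (f u)} ->
  exists c, {in U, forall u, f u = c *: u}.
Proof.
move=> sU sV UV fUV fM fth; have ghom (g : 'End(A)) : {in U, forall u, g u \in V} ->
    {in M & U, forall a u, g (a * u) = a * g u} ->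
    {in U, forall u, g (th u) = th (g u)} ->
  is_ghom M (fun a => restr_hom U U (amull a)) (restr_hom U U th)
    (fun a => restr_hom V V (amull a)) (restr_hom V V th) (restr_hom U V g).
  move=> gUV gM' gth.
  have [/andP[/prodvP MU /parity_stableP thU] _ _] := sU.
  have [/andP[/prodvP NV /parity_stableP thV] _ _] := sV.
  have gE u : vsval (restr_hom U V g u) = g (vsval u).
    by rewrite restr_homE // gUV // subvsP.
  split=> [a Ma|]; apply/lfunP => u; apply: val_inj; rewrite !comp_lfunE /=.
    have aE : vsval (restr_hom U U (amull a) u) = a * vsval u.
      by rewrite restr_homE amullE // MU // subvsP.
    rewrite gE aE gM' ?subvsP // restr_homE amullE gE //.
    by apply: NV; [apply: subvP MN _ Ma | rewrite gUV ?subvsP].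
  have JE : vsval (restr_hom U U th u) = th (vsval u).
    by rewrite restr_homE // thU // subvsP.
  rewrite gE JE gth ?subvsP // restr_homE gE //.
  by rewrite thV // gUV // subvsP.
have idV : {in U, forall u, \1%VF u \in V}.
  by move=> u Uu; rewrite id_lfunE (subvP UV).
have idM : {in M & U, forall a u, \1%VF (a * u) = a * \1%VF u}.
  by move=> a u _ _; rewrite !id_lfunE.
have idth : {in U, forall u, \1%VF (th u) = th (\1%VF u)}.
  by move=> u _; rewrite !id_lfunE.
have := mfMN (gsimple_module gM sU) (gsimple_module gN sV)
  (ghom f fUV fM fth) (ghom \1%VF idV idM idth).
have idE (u : subvs_of U) : vsval (restr_hom U V \1 u) = vsval u.
  by rewrite restr_homE id_lfunE // (subvP UV) // subvsP.
rewrite free_cons seq1_free span_seq1 negb_and !negbK => /orP[/vlineP[c fE]|].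
  exists c => u Uu; have : vsval (restr_hom U V f (vsproj U u)) =
      vsval ((c *: restr_hom U V \1%VF) (vsproj U u)) by rewrite fE.
  by rewrite scale_lfunE linearZ /= idE restr_homE ?vsprojK ?fUV.
move/eqP => id0; case: sU => _ + _; case/eqP; apply/eqP; rewrite -subv0.
apply/subvP => u Uu; rewrite memv0 -(vsprojK Uu) -idE id0 zero_lfunE.
by rewrite linear0.
Qed.

Local Notation M0 := (even_part th M).
Local Notation N0 := (even_part th N).
Local Notation K := (N0 :&: 'C(M0))%VS.

(* A k commuting with M0 need not commute with M, but
   u |-> sum_i b_i * k * even_proj (b^i * u) does, and it agrees with
   multiplication by the central unit casimir M0 times k on even vectors. *)
Lemma branching_scalar U V k :
    gsimple M U -> gsimple N V -> (U <= V)%VS -> k \in K ->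
  exists c, {in U, forall u, th u = u -> casimir M0 * (k * u) = c *: u}.
Proof.
move=> simU simV UV /memv_capP[/even_partP[Nk ek] /centvP kC].
have ssM : ss_subalg M by case/andP: gM.
have [/andP[/prodvP MU /parity_stableP thU] _ _] := simU.
have [/andP[/prodvP NV /parity_stableP thV] _ _] := simV.
have /andP[_ /parity_stableP thM] := gM.
pose f : 'End(A) :=
  (\sum_(i < \dim M) (amull (bas i) \o (amull k \o (even_proj \o amull (dual i)))))%VF.
have fE u : f u = \sum_(i < \dim M) bas i * (k * even_proj (dual i * u)).
  rewrite sum_lfunE; apply: eq_bigr => i _.
  by rewrite !comp_lfunE !amullE.
have fE' u : f u = \sum_(i < \dim M) bas i *
    (amull k \o (even_proj \o amulr u))%VF (dual i).
  by rewrite fE; apply: eq_bigr => i _; rewrite !comp_lfunE amullE amulrE.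
have [|a u Ma Uu|u Uu|c fc] := multiplicity_free_scalar (f := f) simU simV UV.
- move=> u Uu; rewrite fE; apply: memv_suml => i _.
  apply: (NV); first exact: subvP MN _ (bas_mem i).
  apply: (NV) => //; apply: even_proj_mem; first exact/parity_stableP.
  by apply: subvP UV _ _; rewrite MU ?dual_mem.
- rewrite fE' [in RHS]fE' casimir_mull //; apply: eq_bigr => i _.
  by rewrite !comp_lfunE !amullE !amulrE -[dual i * a * u]mulrA.
- transitivity (\sum_(i < \dim M) bas i *
      (amull k \o (even_proj \o amulr u))%VF (th (dual i))).
    rewrite fE; apply: eq_bigr => i _.
    by rewrite !comp_lfunE amullE amulrE -even_proj_parity parityM thK.
  rewrite -casimir_parity // fE' linear_sum; apply: eq_bigr => i _ /=.
  by rewrite parityM !comp_lfunE amullE parityM ek parity_even_proj.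
exists c => u Uu eu; rewrite -fc // fE.
transitivity (\sum_(i < \dim M) bas i *
      (amull k \o amulr u)%VF (even_proj (dual i))).
  rewrite casimir_even // /casimir mulr_suml; apply: eq_bigr => i _.
  by rewrite comp_lfunE amullE amulrE (mulrA k) (kC _ (dual_mem i)) -!mulrA.
apply: eq_bigr => i _.
by rewrite comp_lfunE amullE amulrE even_projMr.
Qed.

(** On even vectors of a simple submodule, [casimir M0 * k] and [casimir M0 * l] act by scalars; the
    Casimir element is invertible and commutes with [K], so the commutator kills these vectors. *)
Lemma branching_centraliser_comm : {in K &, forall x y, x * y = y * x}.
Proof.
move=> k l Kk Kl; pose x := k * l - l * k.
have ssM0 := even_ss gM sM.
have [w [_ _ wc _]] := casimir_inv ssM0.
have kc j : j \in K -> j * casimir M0 = casimir M0 * j.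
  case/memv_capP => _ /centvP jC; apply: jC.
  exact: casimir_mem ssM0.1.
(* Only even vectors are controlled, hence the composition with [even_proj]; the even vector [1]
   suffices to conclude. *)
suff : (N <= lker (amull x \o even_proj))%VS.
  have N1 : 1 \in N by case/andP: gN => /subalg1.
  move/subvP/(_ 1 N1); rewrite memv_ker comp_lfunE amullE even_proj_id ?rmorph1 //.
  by rewrite mulr1 subr_eq0 => /eqP.
apply: (gsub_sum_simple gN sN).
  by case/andP: gN => /andP[_ NN] thN; apply/andP.
move=> V _ simV; apply: (gsub_sum_simple gM sM).
  case: simV => /andP[NV thV] _ _; apply/andP; split=> //.
  exact: subv_trans (prodvSl _ MN) NV.
move=> U UV simU; apply/subvP => u Uu.
rewrite memv_ker comp_lfunE amullE; apply/eqP.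
set v := even_proj u; have ev : th v = v by apply: parity_even_proj.
have Uv : v \in U.
  by case: simU => /andP[_ thU] _ _; apply: even_proj_mem.
have [a ka] := branching_scalar simU simV UV Kk.
have [b lb] := branching_scalar simU simV UV Kl.
have sx : casimir M0 * (casimir M0 * (x * v)) = 0.
  have swap j y : j \in K ->
      casimir M0 * (casimir M0 * (j * y)) = casimir M0 * (j * (casimir M0 * y)).
    by move=> Kj; rewrite (mulrA (casimir M0) j) -(kc j) // -mulrA.
  rewrite /x mulrBl -!mulrA !mulrBr !swap // (lb v) // (ka v) //.
  rewrite -!scalerAr (ka v) // (lb v) //.
  by rewrite !scalerA mulrC subrr.
have unc y : casimir M0 * y = 0 -> y = 0.
  by move=> cy; rewrite -[y]mul1r -wc -mulrA cy mulr0.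
by do 2!apply: (unc).
Qed.

(* K = 'Z(M0) * 'Z(N0) by the double centraliser theorem, since K is
   commutative; hence anything in N0 commuting with G and 'Z(N0) lies in
   M0 * 'Z(N0), and averaging over G pushes it into G * 'Z(N0). *)
Lemma branching_max_comm (G : {vspace A}) x :
    ss_subalg G -> (G <= M0)%VS -> ('Z(M0) <= G)%VS ->
    (M0 :&: 'C(G) <= G)%VS ->
    x \in N0 -> x \in 'C(G)%VS -> x \in 'C('Z(N0))%VS ->
  x \in (G * 'Z(N0))%VS.
Proof.
move=> ssG GM0 ZG maxG N0x xG xZ.
have ssM0 := even_ss gM sM; have ssN0 := even_ss gN sN.
have MN0 : (M0 <= N0)%VS by apply: capvS.
have ZC U : (U <= N0)%VS -> ('Z(N0) <= 'C(U))%VS.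
  move=> UN; apply/centvsP => z d /memv_capP[_ /centvP zC] Ud; apply: zC.
  exact: subvP UN _ Ud.
have KZ : (K <= 'Z(M0) * 'Z(N0))%VS.
  apply/subvP => k Kk; have /memv_capP[N0k kC] := Kk.
  have DZk : k \in (M0 * 'Z(N0))%VS.
    apply: double_centraliser => //; apply/centvP => l Kl.
    exact: branching_centraliser_comm.
  apply: cent_cap_prod DZk kC => //; first exact: ssM0.1.
  exact: ZC.
have MZx : x \in (M0 * 'Z(N0))%VS.
  apply: double_centraliser => //.
  have : (K <= 'C[x])%VS.
    apply: subv_trans KZ _; apply/prodvP => a b Za Zb; apply/cent1vP.
    rewrite -mulrA -(centvP xZ) // !mulrA (centvP xG) //.
    exact: subvP ZG _ Za.
  by rewrite subv_cent1.
have := cent_cap_prod ssG ssM0.1 GM0 (ZC _ (subv_trans GM0 MN0)) MZx xG.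
exact/subvP/prodvSl.
Qed.

End Branching.

End Graded.

End Algebra.

(** * Gelfand-Tsetlin algebras *)

Section Chain.
Variables (F : fieldType) (A : falgType F) (th : 'AEnd(A)).
Variables (n : nat) (Ach : nat -> {vspace A}).
Hypothesis F0 : [pchar F] =i pred0.
Hypothesis thK : forall x, th (th x) = x.
Hypothesis Ach1 : Ach 1%N = 1%VS.
Hypothesis AchS : forall i, (1 <= i < n)%N -> (Ach i <= Ach i.+1)%VS.
Hypothesis Ach_ss :
  forall i, (1 <= i <= n)%N -> graded_subalg th (Ach i) /\ semisimple (Ach i).
Hypothesis Ach_mf :
  forall i, (1 <= i < n)%N -> multiplicity_free th (Ach i) (Ach i.+1).
Local Notation C i := (even_part th (Ach i)).
Local Notation G i := (GZ0 th Ach i).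

Lemma GZ_eq_GZ0 i : (i <= n)%N -> GZ th Ach i = G i.
Proof.
move=> lein; congr agenv; apply: eq_big_nat => j /andP[j1 ji].
have [|gj sj] := Ach_ss (i := j); last exact: graded_center_even.
by rewrite j1 (leq_trans _ lein).
Qed.

(** The new central generators commute with [G i], so the product of the two subalgebras is already
    closed under multiplication. *)
Lemma GZ0_succ i : (1 <= i < n)%N -> ss_subalg (G i) -> (G i <= C i)%VS ->
  G i.+1 = (G i * 'Z(C i.+1))%VS /\ ('Z(C i.+1) <= 'C(G i))%VS.
Proof.
move=> /andP[i1 ltin] ssG GC; set Z := 'Z(_)%VS.
have [|gi sj] := Ach_ss (i := i.+1); first by rewrite ltin.
have ssZ : ss_subalg Z by apply/center_ss/even_ss.
have ZG : (Z <= 'C(G i))%VS.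
  apply/centvsP => z g /memv_capP[_ /centvP zC] Gg; apply: zC.
  have CC : (C i <= C i.+1)%VS by rewrite capvS ?AchS ?i1.
  exact: subvP CC _ (subvP GC _ Gg).
split=> //; have aGZ := prod_subalg ssG.1 ssZ.1 ZG.
have G_GZ : (G i <= G i * Z)%VS.
  by apply/subvP => g Gg; rewrite -[g]mulr1 memv_mul // (subalg1 ssZ.1).
have Z_GZ : (Z <= G i * Z)%VS.
  by apply/subvP => z Zz; rewrite -[z]mul1r memv_mul // (subalg1 ssG.1).
rewrite /GZ0 big_nat_recr //= -/Z; set S := (\sum_(1 <= j < _) _)%VS.
apply/eqP; rewrite eqEsubv; apply/andP; split.
  apply: agenv_sub_modl; first by rewrite -memvE (subalg1 aGZ).
  case/andP: aGZ => _; apply: subv_trans; apply: prodvSl.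
  by rewrite subv_add Z_GZ andbT; apply: subv_trans G_GZ; apply: sub_agenv.
rewrite -[X in (_ <= X)%VS]agenvM; apply: prodvS.
  by apply: agenvS; apply: addvSl.
exact: subv_trans (addvSr _ _) (sub_agenv _).
Qed.

(** Besides maximality, the induction carries semisimplicity of [G i] and the inclusion of the
    center of [C i], both required by [branching_max_comm]. *)
Lemma GZ0_max_comm i : (1 <= i <= n)%N ->
  [/\ ss_subalg (G i), (G i <= C i)%VS, (G i <= 'C(G i))%VS,
      ('Z(C i) <= G i)%VS & (C i :&: 'C(G i) <= G i)%VS].
Proof.
(* Levels start at 1: zero is vacuous, level 1 consists of scalars, and the inductive step goes from
   [i.+1] to [i.+2]. *)
elim: i => // -[_ /andP[_ n1]|i IHi /andP[_ ltin]].
  have [|g1 s1] := Ach_ss (i := 1%N) => //.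
  have C1 : C 1%N = 1%VS.
    apply/eqP; rewrite eqEsubv; apply/andP; split.
      by apply: subv_trans (capvSl _ _) _; rewrite Ach1.
    by rewrite -memvE (subalg1 (even_subalg g1 s1)).
  have G1 : G 1%N = 1%VS.
    apply/eqP; rewrite eqEsubv sub1_agenv andbT; apply: agenv_sub_modl => //.
    by rewrite prodv1 big_nat1 C1 capvSl.
  rewrite G1 C1; split=> //; try exact: capvSl.
    by rewrite -C1; apply: even_ss.
  by rewrite -memvE centv1.
have [|ssG GC GG ZG maxG] := IHi; first exact: ltnW.
have [|GE ZcG] := GZ0_succ (i := i.+1) _ ssG GC; first exact: ltin.
have [|gM sM] := Ach_ss (i := i.+1); first by rewrite /= ltnW.
have [|gN sN] := Ach_ss (i := i.+2); first exact: ltin.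
have MN := AchS (i := i.+1) ltin.
have ssN := even_ss F0 thK gN sN.
have ssZ := center_ss F0 ssN; have aN := ssN.1.
have CC : (C i.+1 <= C i.+2)%VS by apply: capvS.
have GZC : (G i.+2 <= C i.+2)%VS.
  rewrite GE; apply/prodvP => g z Gg /memv_capP[Cz _]; apply: (subalgM aN) => //.
  by rewrite (subvP CC) // (subvP GC).
have ZGG : ('Z(C i.+2) <= G i.+2)%VS.
  rewrite GE; apply/subvP => z Zz.
  by rewrite -[z]mul1r memv_mul // (subalg1 ssG.1).
have GGG : (G i.+1 <= G i.+2)%VS.
  rewrite GE; apply/subvP => z Zz.
  by rewrite -[z]mulr1 memv_mul // (subalg1 ssZ.1).
have ZCC : ('Z(C i.+2) <= 'C(G i.+2))%VS.
  apply/centvsP => z d /memv_capP[_ /centvP zC] Ud; apply: zC.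
  exact: subvP GZC _ Ud.
split=> //.
- by rewrite GE; apply: prod_ss.
- rewrite {1}GE; apply/prodvP => g z Gg Zz.
  apply: (memvM (A := 'C(G i.+2)%AS)); last exact: subvP ZCC _ Zz.
  move: g Gg; apply/subvP; rewrite centvC GE; apply/prodvP => g' z' Gg' Zz'.
  apply: (memvM (A := 'C(G i.+1)%AS)); first exact: subvP GG _ Gg'.
  exact: subvP ZcG _ Zz'.
apply/subvP => x /memv_capP[Cx /centvP xC].
rewrite GE; apply: (branching_max_comm F0 thK gM sM gN sN MN) => //.
- exact: (Ach_mf (i := i.+1)).
- by apply/centvP => g Gg; apply: xC; apply: subvP GGG _ Gg.
by apply/centvP => g Gg; apply: xC; apply: subvP ZGG _ Gg.
Qed.

End Chain.

(** * Homogeneous eigenbases *)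

Section Diagonalization.
Variables (F : closedFieldType) (A : falgType F) (G : {vspace A}).
Hypothesis F0 : [pchar F] =i pred0.
Hypotheses (ssG : ss_subalg G) (commG : (G <= 'C(G))%VS).

(** A nonzero [h] would yield a nonzero idempotent [u * h]; by commutativity its powers involve
    powers of [h], which vanish. *)
Lemma comm_ss_reduced h k : h \in G -> h ^+ k = 0 -> h = 0.
Proof.
move=> Gh hk; have [//|nzh] := eqVneq h 0.
have [|||e [/memv_cosetP[u Gu eE] nze ee]] :=
  left_ideal_idempotent ssG.1 ssG.2 (L := (G * <[h]>)%VS).
- by apply/prodvP => u v Gu /vlineP[c ->]; rewrite -scalerAr memvZ ?(subalgM ssG.1).
- by rewrite prodvA; apply: prodvSl; case/andP: ssG.1.
- apply: contra nzh => /eqP Gh0; rewrite -memv0 -Gh0 -{1}[h]mul1r.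
  by rewrite memv_mul ?memv_line ?(subalg1 ssG.1).
have eX m : e ^+ m.+1 = e by elim: m => // m IHm; rewrite exprS IHm.
case/eqP: nze; rewrite -(eX k) {1}eE exprMn_comm.
  by rewrite (exprSr h) hk mul0r mulr0.
exact: (centvP (subvP commG _ Gu)).
Qed.

Lemma horner_alg_mem g p : g \in G -> horner_alg g p \in G.
Proof.
move=> Gg; elim/poly_ind: p => [|p c IHp]; first by rewrite rmorph0 mem0v.
rewrite rmorphD rmorphM /= horner_algX horner_algC memvD ?(subalgM ssG.1) //.
by rewrite memvZ // (subalg1 ssG.1).
Qed.

Lemma algebra_annihilator (g : A) : exists2 p : {poly F}, p != 0 & horner_alg g p = 0.
Proof.
(* One more power of [g] than the dimension of [A], so these powers are linearly dependent. *)
pose d := (\dim {:A}).+1.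
pose powers (v : 'rV[F]_d) := \sum_(i < d) v 0 i *: g ^+ i.
have lin : linear powers.
  move=> c u v; rewrite /powers scaler_sumr -big_split; apply: eq_bigr => i _.
  by rewrite !mxE scalerDl scalerA.
pose phi := HB.pack_for {linear 'rV[F]_d -> A} powers
  (GRing.isSemilinear.Build F 'rV[F]_d A _ _ (GRing.semilinear_linear lin)).
have nzker : lker (linfun phi) != 0%VS.
  rewrite -dimv_eq0; have := limg_ker_dim (linfun phi) fullv.
  rewrite capfv dimvf dim_matrix mul1r /d => dimE; apply/eqP => ker0.
  by have := dimvS (subvf (limg (linfun phi))); rewrite -ltnS -dimE ker0 add0n ltnn.
pose v := vpick (lker (linfun phi)).
have v0 : powers v = 0.
  by have := memv_pick (lker (linfun phi)); rewrite memv_ker lfunE => /eqP.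
exists (\poly_(i < d) v 0 (inord i)).
  apply: contraNneq nzker => p0; rewrite -vpick0 -/v; apply/eqP/rowP => i.
  have := congr1 (fun p : {poly F} => p`_i) p0.
  by rewrite coef_poly ltn_ord inord_val coef0 mxE.
rewrite poly_def rmorph_sum /=.
under eq_bigr => i _ do rewrite linearZ /= rmorphXn /= horner_algX inord_val mulr_algl.
exact: v0.
Qed.

(** An annihilating polynomial [p] splits and divides a power of its radical [q]; so [q] at [g] is
    nilpotent in [G], hence zero. *)
Lemma ss_squarefree_annihilator g : g \in G ->
  exists2 rs, uniq rs & horner_alg g (\prod_(r <- rs) ('X - r%:P)) = 0.
Proof.
move=> Gg; have [p nzp p0] := algebra_annihilator g.
have [s pE] := closed_field_poly_normal p.
exists (undup s); first exact: undup_uniq.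
set q := \prod_(r <- _) _.
have qdvd t : {subset t <= s} -> \prod_(z <- t) ('X - z%:P) %| q ^+ size t.
  elim: t => [|z t IHt] sub_ts; first by rewrite big_nil dvd1p.
  rewrite big_cons exprS dvdp_mul ?IHt //.
    by rewrite dvdp_XsubCl root_prod_XsubC mem_undup sub_ts ?mem_head.
  by move=> y ty; rewrite sub_ts // in_cons ty orbT.
apply: (comm_ss_reduced (k := size s)); first exact: horner_alg_mem.
have /dvdpP[u uE] := qdvd s (fun _ => id).
rewrite -rmorphXn /= uE rmorphM /=; suff -> : horner_alg g (\prod_(z <- s) ('X - z%:P)) = 0.
  by rewrite mulr0.
move: p0; rewrite pE linearZ /= mulr_algl => /eqP; rewrite scaler_eq0 lead_coef_eq0.
by rewrite (negPf nzp) => /eqP.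
Qed.

(** The matrices commute and are annihilated by split squarefree polynomials, which for [J] is
    [X^2 - 1]. [R] reverses products because [mxof] acts on row vectors. *)
Lemma representation_codiagonalizable m (R : A -> 'M[F]_m) (J : 'M[F]_m) :
    R 1 = 1%:M -> (forall k a b, R (k *: a + b) = k *: R a + R b) ->
    {in G &, forall a b, R (a * b) = R b *m R a} ->
    J *m J = 1%:M -> {in G, forall g, J *m R g = R g *m J} ->
  exists2 P, P \in unitmx &
    {in J :: map R (vbasis G), forall M, exists d, P *m M = diag_mx d *m P}.
Proof.
case: m R J => [|m] R J R1 Rlin RM JJ JR.
  by exists 1%:M; rewrite ?unitmx1 // => M _; exists 0; apply/matrixP => -[].
have R_horner g p : g \in G -> horner_mx (R g) p = R (horner_alg g p).
  have R0 : R 0 = 0.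
    by have := Rlin (-1) 0 0; rewrite scaleN1r addNr scaleN1r addNr.
  have RD a b : R (a + b) = R a + R b by have := Rlin 1 a b; rewrite !scale1r.
  have RZ k a : R (k *: a) = k *: R a by have := Rlin k a 0; rewrite R0 !addr0.
  move=> Gg; elim/poly_ind: p => [|p c IHp]; first by rewrite !rmorph0 R0.
  rewrite (mulrC p) !rmorphD !rmorphM /= horner_mx_X horner_mx_C.
  rewrite horner_algX horner_algC RD RZ R1 scalemx1 IHp.
  rewrite (centvP (subvP commG _ Gg)) ?horner_alg_mem //.
  by rewrite RM ?horner_alg_mem.
pose s := J :: map R (vbasis G).
have [|P Pu /allP Pdiag] := (codiagonalizableP s).1; last first.
- exists P => // M /Pdiag/diagonalizable_forPex[d /(simmxP Pu) PM].
  by exists d.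
split=> [a b|M]; rewrite /s !inE.
  have comm_mxR : {in vbasis G &, forall a b, comm_mx (R a) (R b)}.
    move=> x y /vbasis_mem Gx /vbasis_mem Gy.
    by rewrite /comm_mx -!RM // (centvP (subvP commG _ Gx)).
  case/orP=> [/eqP->|/mapP[x bx ->]] /orP[/eqP->|/mapP[y by_ ->]].
  - by [].

  - by rewrite /comm_mx JR // vbasis_mem.
  - by rewrite /comm_mx JR // vbasis_mem.
  exact: comm_mxR.
move=> sM; apply/diagonalizableP; case/orP: sM => [/eqP->|/mapP[x bx ->]].
  have n2 : (2%:R : F) != 0 by rewrite ((pcharf0P _).1 F0).
  exists [:: 1; -1].
    rewrite /= inE andbT -subr_eq0 opprK -mulr2n; exact: n2.
  apply: mxminpoly_min; rewrite !big_cons big_nil mulr1 polyCN opprK.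
  have -> : ('X - 1%:P) * ('X + 1%:P) = 'X ^+ 2 - 1 :> {poly F}.
    by rewrite polyC1 -subr_sqr expr1n.
  rewrite rmorphB rmorphXn rmorph1 /= horner_mx_X expr2.
  by rewrite -mulmxE JJ subrr.
have Gx := vbasis_mem bx; have [rs urs rs0] := ss_squarefree_annihilator Gx.
exists rs => //; apply: mxminpoly_min; rewrite R_horner // rs0.
by have := Rlin (-1) 0 0; rewrite scaleN1r addNr scaleN1r addNr.
Qed.

(** The rows of [P], read in a basis of [V], are the eigenvectors. [J] commutes with [rho g] because
    [g] is even, and [J \o J = \1] leaves only signs as eigenvalues of [J], which is homogeneity. *)
Lemma homogeneous_eigenbasis th (V : vectType F) (rho : A -> 'End(V)) (J : 'End(V)) :
    (G <= even_part th fullv)%VS -> graded_module th fullv rho J ->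
  exists X : seq V, basis_of fullv X /\
    forall x, x \in X -> (J x = x \/ J x = - x) /\
      forall g, g \in G -> exists c : F, rho g x = c *: x.
Proof.
move=> Gev [rho1 rhoL rhoM JJ rhoJ].
pose e := vbasis {:V}; have eb : basis_of {:V} e := vbasisP _.
pose R a := mxof e e (rho a); pose Jm := mxof e e J.
have [||a b Ga Gb||g Gg|P Pu Pdiag] := @representation_codiagonalizable _ R Jm.
- by rewrite /R rho1 mxof1 // (basis_free eb).
- by move=> k a b; rewrite /R rhoL ?memvf // linearP.
- by rewrite /R rhoM ?memvf // (mxof_comp _ _ eb).
- by rewrite /Jm -(mxof_comp _ _ eb) JJ mxof1 // (basis_free eb).
- have /memv_capP[_ /fixedSpaceP eg] := subvP Gev _ Gg.
  rewrite /Jm /R -!(mxof_comp _ _ eb); congr mxof.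
  rewrite -{1}eg rhoJ ?memvf // -!comp_lfunA JJ comp_lfun1r.
  by [].
pose x i := vecof e (row i P).
have eig f d : P *m mxof e e f = diag_mx d *m P -> forall i, f (x i) = d 0 i *: x i.
  move=> Pf i; rewrite /x (hom_vecof _ eb) -row_mul Pf row_mul row_diag_mx.
  by rewrite -scalemxAl -rowE linearZ.
have xfree : free [tuple x i | i < \dim {:V}].
  apply/freeP => k; under eq_bigr => i _ do rewrite -tnth_nth tnth_mktuple.
  move=> kx; pose u : 'rV_(\dim {:V}) := \row_i k i.
  have uP0 : vecof e (u *m P) = 0.
    rewrite mulmx_sum_row linear_sum -[RHS]kx; apply: eq_bigr => i _ /=.
    by rewrite linearZ mxE.
  have u0 : u = 0.
    apply: (row_free_inj (A := P)); first by rewrite row_free_unit.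
    by apply/eqP; rewrite /= mul0mx -(vecof_eq0 eb) uP0 eqxx.
  by move=> i; have := congr1 (fun v : 'rV_ _ => v 0 i) u0; rewrite !mxE.
exists [tuple x i | i < \dim {:V}]; split.
  by rewrite basisEfree xfree subvf size_tuple leqnn.
move=> _ /tnthP[i ->]; rewrite tnth_mktuple; split.
  have [d /eig/(_ i) Jx] := Pdiag Jm (mem_head _ _).
  have nzx : x i != 0.
    apply: (free_not0 xfree); apply/tnthP; exists i; by rewrite tnth_mktuple.
  have : d 0 i ^+ 2 == 1.
    have : (J \o J)%VF (x i) = x i by rewrite JJ id_lfunE.
    rewrite comp_lfunE Jx linearZ /= Jx scalerA => /eqP.
    by rewrite -subr_eq0 -{2}[x i]scale1r -scalerBl scaler_eq0 (negPf nzx) orbF subr_eq0.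
  rewrite sqrf_eq1 => /orP[] /eqP dE; rewrite Jx dE; [left|right].
    by rewrite scale1r.
  by rewrite scaleN1r.
have rhoLv k a b : rho (k *: a + b) = k *: rho a + rho b by apply: rhoL; apply: memvf.
have rho0 : rho 0 = 0.
  by have := rhoLv (-1) 0 0; rewrite scaleN1r addNr scaleN1r addNr.
move=> g /coord_vbasis ->; elim/big_ind: _ => [|a b [c ac] [d bd]|j _].
- by exists 0; rewrite rho0 zero_lfunE scale0r.
- exists (c + d); have := rhoLv 1 a b; rewrite !scale1r => ->.
  by rewrite add_lfunE ac bd scalerDl.
have [|d /eig/(_ i) Rx] := Pdiag (R (vbasis G)`_j).
  by rewrite inE map_f ?orbT // mem_nth // size_tuple.
exists (coord (vbasis G) j g * d 0 i).
have := rhoLv (coord (vbasis G) j g) (vbasis G)`_j 0; rewrite rho0 !addr0 => ->.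
by rewrite scale_lfunE Rx scalerA.
Qed.

End Diagonalization.

Theorem mainTheorem9 (F : closedFieldType) (hF : [pchar F] =i pred0)
  (A : falgType F) (th : 'AEnd(A)) (n : nat) (Ach : nat -> {vspace A}) :
  (forall x : A, th (th x) = x) ->
  (1 <= n)%N ->
  Ach 1%N = 1%VS ->
  Ach n = fullv ->
  (forall i, (1 <= i < n)%N -> (Ach i <= Ach i.+1)%VS) ->
  (forall i, (1 <= i <= n)%N -> graded_subalg th (Ach i) /\ semisimple (Ach i)) ->
  (* the branching graph has no multiple edges:
     dim GHom_{A(i)}(U, V) <= 1 for simple graded A(i)-module U and
     simple graded A(i+1)-module V *)
  (forall i, (1 <= i < n)%N ->
     forall (U V : vectType F) (rhoU : A -> 'End(U)) (JU : 'End(U))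
            (rhoV : A -> 'End(V)) (JV : 'End(V)),
       simple_gmodule th (Ach i) rhoU JU ->
       simple_gmodule th (Ach i.+1) rhoV JV ->
       forall f g : 'Hom(U, V),
         is_ghom (Ach i) rhoU JU rhoV JV f ->
         is_ghom (Ach i) rhoU JU rhoV JV g ->
         ~~ free [:: f; g]) ->
  [/\ GZ th Ach n = GZ0 th Ach n,
      (* maximal commutative subalgebra of A(n)_0 *)
      [/\ (GZ th Ach n <= even_part th fullv)%VS,
          {in GZ th Ach n &, forall x y, x * y = y * x} &
          forall B : {vspace A},
            (B <= even_part th fullv)%VS -> 1 \in B -> (B * B <= B)%VS ->
            {in B &, forall x y, x * y = y * x} ->
            (GZ th Ach n <= B)%VS -> B = GZ th Ach n] &
      (* homogeneous common eigenbasis of every simple graded A(n)-module *)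
      forall (V : vectType F) (rho : A -> 'End(V)) (J : 'End(V)),
        simple_gmodule th fullv rho J ->
        exists X : seq V,
          basis_of fullv X /\
          forall x, x \in X ->
            (J x = x \/ J x = - x) /\
            forall g, g \in GZ th Ach n -> exists c : F, rho g x = c *: x].
Proof.
move=> thK n1 Ach1 Achn AchS Ach_ss Ach_mf.
have [|ssG GC GG _ maxG] := GZ0_max_comm hF thK Ach1 AchS Ach_ss Ach_mf (i := n).
  by rewrite n1 leqnn.
rewrite (GZ_eq_GZ0 hF thK Ach_ss (leqnn n)); rewrite Achn in GC maxG.
split=> //; last first.
  move=> V rho J [gV _ _]; exact: (homogeneous_eigenbasis hF ssG GG GC gV).
split=> // [x y Gx Gy|B Beven _ _ commB GB].
  exact: (centvP (subvP GG _ Gx)).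
(* A commutative [B] containing the Gelfand-Tsetlin algebra centralises it, and that algebra
   contains its own centraliser in the even part. *)
apply/eqP; rewrite eqEsubv GB andbT; apply/subvP => x Bx.
apply: (subvP maxG x); rewrite memv_cap (subvP Beven) //=; apply/centvP => g Gg.
by apply: commB => //; apply: subvP GB _ Gg.
Qed.
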